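(* Let $M$ be an $n$-paving matroid. Then $I_M^{\mathrm{lift}}\subset I_M^{\mathrm{graph}}$. If in addition $M$ has no points of degree greater than two, then $$I_M=\sqrt{I_{\mathcal{C}(M)}+I_M^{\mathrm{graph}}},$$ and this gives a finite generating set of $I_M$ up to radical: $I_M$ is the radical of the ideal generated by the (finitely many) generating minors of $I_{\mathcal{C}(M)}$ together with the finitely many graph polynomials of $M$ whose extra vectors are all taken from the canonical basis $\{e_1,\dots,e_n\}$ of $\mathbb{C}^n$.
   Context: A matroid $M$ of rank $n$ is called $n$-paving if every circuit of $M$ has size $n$ or $n+1$. Elements of the ground set $\mathcal{P}_M$ are called points, and $|M|$ is the number of points. A dependent hyperplane of $M$ is a maximal subset of $\mathcal{P}_M$ with at least $n$ elements all of whose $n$-element subsets are circuits. The degree of a point $p$ is the number of dependent hyperplanes containing $p$. A submatroid of $M$ is the restriction of $M$ to a subset of its ground set; a submatroid of full rank of an $n$-paving matroid is again $n$-paving. $\overline{J}$ denotes the closure of $J\subset\mathcal{P}_M$ in $M$. Let $X$ be an $n\times|M|$ matrix of indeterminates with columns indexed by $\mathcal{P}_M$. For $p_1,\dots,p_k\in\mathcal{P}_M$ and $v_1,\dots,v_{n-k}\in\mathbb{C}^n$, $[p_1,\dots,p_k,v_1,\dots,v_{n-k}]\in\mathbb{C}[X]$ is the determinant of the matrix whose columns are, in this order, the columns of $X$ indexed by $p_1,\dots,p_k$ and the vectors $v_1,\dots,v_{n-k}$. A hat over an entry means that it is omitted. Matroid ideal: $\Gamma_M\subset\mathbb{C}^{n|M|}$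 is the set of all collections $\gamma=(\gamma_p)_{p\in\mathcal{P}_M}$ of vectors in $\mathbb{C}^n$ such that, for every $S\subset\mathcal{P}_M$, $(\gamma_p)_{p\in S}$ is linearly dependent if and only if $S$ is dependent in $M$. $V_M$ is the Zariski closure of $\Gamma_M$, and $I_M\subset\mathbb{C}[X]$ is the ideal of $V_M$. Circuit ideal: $I_{\mathcal{C}(M)}$ is the ideal of $\mathbb{C}[X]$ generated by all minors of $X$ with column set $B$ and row set $A\subset[n]$, where $B$ is a circuit of $M$ and $|A|=|B|$. Lifting ideal: for an $n$-paving matroid $N$ and $q\in\mathbb{C}^n$, the liftability matrix $\mathcal{M}_q(N)$ has columns indexed by the points of $N$ and rows indexed by the circuits of size $n$ of $N$; in the row of an $n$-circuit $c=\{c_1,\dots,c_n\}$ (elements listed in some fixed order), the entry in column $c_i$ is $(-1)^{i-1}[c_1,\dots,\hat{c_i},\dots,c_n,q]$ and all other entries are $0$. $I_M^{\mathrm{lift}}$ is the ideal generated by all $(|N|-n+1)$-minors of the matrices $\mathcal{M}_q(N)$, with $N$ varying over all submatroids of $M$ of full rank $n$ and $q$ over $\mathbb{C}^n$. Graph polynomials: let $J\subset\mathcal{P}_M$ and $P=\{p_1,\dots,p_k\}\subset\mathcal{P}_M$ with $P\cap\overline{J}=\emptyset$, let $c_1,\dots,c_k$ be circuits of $M$ of size $n$ with $p_i\in c_i\subset P\cup J$ for all $i$, and let $q_1,\dots,q_k\in\mathbb{C}^n$ (the extra vectors). List the elements of $c_i$ as $c_{i,1},\dots,c_{i,n}$ with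 $c_{i,1}=p_i$ and with the elements of $P$ preceding those of $J$. Let $G$ be the directed graph with vertices $p_1,\dots,p_k$ and edges $(p_i,p_j)$ for $j\ne i$, $p_j\in c_i$. Put $D_i=[c_{i,2},\dots,c_{i,n},q_i]$ and, for an edge $(p_i,p_j)$ with $p_j=c_{i,s}$, put $N_{i,j}=(-1)^{s}[c_{i,1},\dots,\widehat{c_{i,s}},\dots,c_{i,n},q_i]$. Let $C(G)$ be the set of non-empty collections of pairwise vertex-disjoint directed (simple) cycles of $G$. The associated graph polynomial is $$\prod_{i=1}^kD_i+\sum_{K\in C(G)}(-1)^{|K|}\prod_{(p_i,p_j)\text{ edge of a cycle in }K}N_{i,j}\ \prod_{p_i\text{ on no cycle of }K}D_i,$$ where $|K|$ is the number of cycles in $K$. (Equivalently, substitute $\alpha_{i,j}=N_{i,j}/D_i$ in $1+\sum_{K\in C(G)}(-1)^{|K|}\prod\alpha_{i,j}$, the product being over edges of cycles in $K$, and multiply by $\prod_iD_i$.) $I_M^{\mathrm{graph}}$ is the ideal generated by all graph polynomials, over all such choices of $J$, $P$, circuits and extra vectors. *)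

(* Defs.v *)
From HB Require Import structures.
From mathcomp Require Import all_boot all_order all_algebra.
From mathcomp Require Import classical_sets cardinality reals complex mpoly.
(* so that set0, setDP and the like refer to {set T} *)
From mathcomp Require Import finset.

Set Implicit Arguments.
Unset Strict Implicit.
Unset Printing Implicit Defensive.

Import GRing.Theory.
Local Open Scope ring_scope.

(* ------------------------------- Matroids ------------------------------- *)

Record matroid (E : finType) := Matroid {
  indep : {set E} -> bool;
  indep_set0 : indep set0;
  indep_sub : forall A B : {set E}, A \subset B -> indep B -> indep A;
  indep_aug : forall A B : {set E}, indep A -> indep B -> (#|A| < #|B|)%N ->
    exists2 x, x \in B :\: A & indep (x |: A) }.

Section MatroidNotions.
Variables (E : finType) (M : matroid E).
Implicit Types (A C H J : {set E}) (p : E).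

Definition rank A : nat := \max_(B : {set E} | (B \subset A) && indep M B) #|B|.

Definition circuit C : bool := minset (fun D => ~~ indep M D) C.

Definition matroid_closure J : {set E} := [set x | rank (x |: J) == rank J].

Definition paving (n : nat) : Prop :=
  rank [set: E] = n /\ (forall C, circuit C -> #|C| = n \/ #|C| = n.+1).

Definition dep_hyperplane (n : nat) : pred {set E} :=
  maxset (fun H => (n <= #|H|)%N &&
    [forall C : {set E}, (C \subset H) && (#|C| == n) ==> circuit C]).

Definition degree (n : nat) p : nat :=
  #|[set H : {set E} | dep_hyperplane n H & p \in H]|.

End MatroidNotions.

Section Restriction.
Variables (E : finType) (M : matroid E) (S : {set E}).
Let F : finType := {x : E | x \in S}.

Let rindep (A : {set F}) : bool := indep M [set val x | x in A].

Fact rindep_set0 : rindep set0.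
Proof. by rewrite /rindep imset0 indep_set0. Qed.

Fact rindep_sub (A B : {set F}) : A \subset B -> rindep B -> rindep A.
Proof. by move=> sAB; apply: indep_sub; apply: imsetS. Qed.

Fact rindep_aug (A B : {set F}) : rindep A -> rindep B -> (#|A| < #|B|)%N ->
  exists2 x, x \in B :\: A & rindep (x |: A).
Proof.
move=> iA iB ltAB.
have [|_ /setDP[/imsetP[x xB ->] xA] ix] := indep_aug iA iB.
  by rewrite !card_imset //; apply: val_inj.
exists x; last by rewrite /rindep imsetU1.
by rewrite inE xB andbT; apply: contra xA; apply: imset_f.
Qed.

Definition restriction : matroid F :=
  Matroid rindep_set0 rindep_sub rindep_aug.

End Restriction.

(* -------------------------------- Ideals -------------------------------- *)

Section Ideals.
Variable A : comNzRingType.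
Implicit Types (I J G : set A).
Local Open Scope classical_set_scope.

Definition is_ideal I : Prop :=
  [/\ I 0, (forall a b, I a -> I b -> I (a + b))
    & (forall a b, I b -> I (a * b))].

Definition ideal_gen G : set A := smallest is_ideal G.

Definition ideal_add I J : set A := [set a + b | a in I & b in J].

Definition radical I : set A := [set a | exists k : nat, I (a ^+ k)].

End Ideals.

(* Minors are taken on increasing families of rows and columns. *)
Definition increasing r m (f : 'I_r -> 'I_m) : Prop :=
  forall i j : 'I_r, (i < j)%N -> (f i < f j)%N.

Definition is_minor (A : comNzRingType) (m n : nat) (Y : 'M[A]_(m, n)) (r : nat)
    (a : A) : Prop :=
  exists f : 'I_r -> 'I_m, exists g : 'I_r -> 'I_n,
    [/\ increasing f, increasing g & a = \det (mxsub f g Y)].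

(* The determinant with the given list of columns, which is meant to have
   length n. *)
Definition det_cols (A : comNzRingType) (n : nat) (s : seq 'cV[A]_n) : A :=
  \det (\matrix_(i < n, j < n) s`_j i 0).

(* ----------- Polynomials in an n x |E| matrix of indeterminates ---------- *)

(* The columns are indexed by E through its enumeration, and the variables of
   {mpoly K[n * #|E|]} are the entries of the matrix through [mxvec_index]. *)
Notation "{ 'mxpoly' K [ n , E ] }" := {mpoly K[(n * #|E|)%N]}
  (at level 0, K at level 2, n, E at level 200,
   format "{ 'mxpoly'  K [ n ,  E ] }") : type_scope.

Section MatroidIdeals.
Variables (K : fieldType) (n : nat) (E : finType).
Local Notation ring := {mxpoly K[n, E]}.

Definition generic_mx : 'M[ring]_(n, #|E|) :=
  \matrix_(i, j) 'X_(mxvec_index i j).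

Definition generic_col (p : E) : 'cV[ring]_n := col (enum_rank p) generic_mx.

Definition const_col (v : 'cV[K]_n) : 'cV[ring]_n := map_mx (@mpolyC _ K) v.

Definition bracket (s : seq E) (vs : seq 'cV[K]_n) : ring :=
  det_cols (map generic_col s ++ map const_col vs).

Definition canonical_vec (v : 'cV[K]_n) : Prop :=
  exists i : 'I_n, v = delta_mx i 0.

(* Points of K^(n|E|) are matrices whose columns are the vectors gamma_p. *)
Definition mx_eval (gamma : 'M[K]_(n, #|E|)) (f : ring) : K :=
  f.@[mxvec gamma 0].

Section ZariskiTopology.
Local Open Scope classical_set_scope.

Definition zariski_closed (Z : set 'M[K]_(n, #|E|)) : Prop :=
  exists F : set ring,
    Z = [set gamma | forall f, F f -> mx_eval gamma f = 0].

Definition zariski_closure (Z : set 'M[K]_(n, #|E|)) :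
  set 'M[K]_(n, #|E|) := smallest zariski_closed Z.

Definition vanishing_ideal (Z : set 'M[K]_(n, #|E|)) : set ring :=
  [set f | forall gamma, Z gamma -> mx_eval gamma f = 0].

End ZariskiTopology.

Variable M : matroid E.

Definition realization_space : set 'M[K]_(n, #|E|) :=
  fun gamma => forall S : {set E},
    ~~ free [seq col (enum_rank p) gamma | p <- enum S] <-> ~~ indep M S.

Definition matroid_variety : set 'M[K]_(n, #|E|) :=
  zariski_closure realization_space.

Definition matroid_ideal : set ring := vanishing_ideal matroid_variety.

Definition circuit_minor : set ring :=
  fun f => exists r : nat, exists a : 'I_r -> 'I_n, exists b : 'I_r -> 'I_#|E|,
    [/\ increasing a, increasing b, circuit M [set enum_val (b j) | j in 'I_r]
      & f = \det (mxsub a b generic_mx)].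

Definition circuit_ideal : set ring := ideal_gen circuit_minor.

(* The liftability matrix of a matroid N whose points are mapped to E by
   [iota]; [enum c] is the fixed order on the elements of a circuit c. *)
Section Liftability.
Variables (F : finType) (iota : F -> E) (N : matroid F) (q : 'cV[K]_n).

Definition ncircuits : {set {set F}} :=
  [set c | circuit N c & #|c| == n].

Definition liftability_entry (c : {set F}) (p : F) : ring :=
  if p \in c then
    (-1) ^+ index p (enum c) * bracket (map iota (rem p (enum c))) [:: q]
  else 0.

Definition liftability_mx : 'M[ring]_(#|ncircuits|, #|F|) :=
  \matrix_(i, j) liftability_entry (enum_val i) (enum_val j).

End Liftability.

Definition lift_poly : set ring :=
  fun f => exists (S : {set E}) (q : 'cV[K]_n),
    rank M S = n /\
    is_minor (liftability_mx val (restriction M S) q) (#|S| - n + 1) f.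

Definition lift_ideal : set ring := ideal_gen lift_poly.

Section GraphPolynomial.
Variables (k : nat) (p : 'I_k -> E) (c : 'I_k -> seq E) (q : 'I_k -> 'cV[K]_n).

(* The vertex p_i is represented by its index i. *)
Definition edge : rel 'I_k := [rel i j | (j != i) && (p j \in c i)].

(* A directed cycle is represented by its set of edges. *)
Definition simple_cycle (Z : {set 'I_k * 'I_k}) : bool :=
  [exists m : 'I_k.+1, [exists s : m.-tuple 'I_k,
    [&& (0 < m)%N, cycle edge s, uniq s &
        Z == [set (i, next s i) | i in tval s]]]].

Definition cycle_vertices (Z : {set 'I_k * 'I_k}) : {set 'I_k} :=
  [set a.1 | a in Z].

Definition cycle_collections : {set {set {set 'I_k * 'I_k}}} :=
  [set C | [&& C != set0, [forall Z in C, simple_cycle Z] &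
     [forall Z1 in C, [forall Z2 in C, (Z1 != Z2) ==>
       [disjoint cycle_vertices Z1 & cycle_vertices Z2]]]]].

Definition vertex_weight (i : 'I_k) : ring := bracket (behead (c i)) [:: q i].

(* [index] is 0-based, so the 1-based position s is [(index _ _).+1]. *)
Definition edge_weight (i j : 'I_k) : ring :=
  (-1) ^+ (index (p j) (c i)).+1 * bracket (rem (p j) (c i)) [:: q i].

Definition graph_polynomial : ring :=
  \prod_(i < k) vertex_weight i +
  \sum_(C in cycle_collections)
    (-1) ^+ #|C| *
    (\prod_(a in cover C) edge_weight a.1 a.2) *
    (\prod_(i < k | i \notin cycle_vertices (cover C)) vertex_weight i).

End GraphPolynomial.

(* [c i] lists the n-circuit c_i with p_i first and P before J.  The family p
   must be nonempty: for k = 0 the graph polynomial would be 1. *)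
Definition graph_choice (J : {set E}) (k : nat) (p : 'I_k -> E)
    (c : 'I_k -> seq E) : Prop :=
  let P := [set p i | i in 'I_k] in
  [/\ (0 < k)%N, injective p, [disjoint P & matroid_closure M J]
    & forall i,
      [/\ circuit M [set x in c i], uniq (c i) & size (c i) = n] /\
      [/\ ohead (c i) = Some (p i), [set x in c i] \subset P :|: J
        & forall x y, x \in c i -> y \in c i -> x \in P -> y \in J ->
            (index x (c i) < index y (c i))%N]].

(* The graph polynomials of M whose extra vectors all satisfy [V]. *)
Definition graph_poly_on (V : 'cV[K]_n -> Prop) : set ring :=
  fun f => exists (J : {set E}) (k : nat) (p : 'I_k -> E) (c : 'I_k -> seq E)
    (q : 'I_k -> 'cV[K]_n),
    [/\ graph_choice J p c, forall i, V (q i) & f = graph_polynomial p c q].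

Definition graph_poly : set ring := graph_poly_on (fun=> True).

Definition canonical_graph_poly : set ring := graph_poly_on canonical_vec.

Definition graph_ideal : set ring := ideal_gen graph_poly.

End MatroidIdeals.

Arguments matroid_ideal K n {E} M.
Arguments circuit_minor K n {E} M.
Arguments circuit_ideal K n {E} M.
Arguments lift_poly K n {E} M.
Arguments lift_ideal K n {E} M.
Arguments graph_poly K n {E} M.
Arguments canonical_graph_poly K n {E} M.
Arguments graph_ideal K n {E} M.

(* Main.v *)
(* The matrix whose row (c_i, q_i) has entry (-1)^s [c_i minus p_j, q_i] in the column of
   the s-th element p_j of c_i has the graph polynomial as determinant: a permutation is
   the collection of its nontrivial cycles.  Up to sign, the entries of such a row are
   the values of det(gamma_c) with the column of p replaced by q, so that the values
   z_p are orthogonal to all the rows exactly when the vectors gamma_p + z_p q of each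
   circuit remain dependent.  Hence graph polynomials vanish on realizations (take for z
   a functional killing J but not P), and a minor of a liftability matrix with columns
   P0 reduces, by Laplace expansion along the columns lying in the closure of the
   complement of P0, to graph polynomials.

   Let now gamma be a common zero of the circuit minors and of the canonical graph
   polynomials.  Each dependent hyperplane H is sent into some hyperplane of normal h_H.
   If the normals of the (at most two) dependent hyperplanes through each point are
   independent, then gamma can be moved along curves to a realization.  Otherwise
   several dependent hyperplanes D share the same normal h.  If D is rigid, that is, if
   all first-order motions of these hyperplanes along which their common points can be
   followed are trivial, then a graph polynomial with J in D does not vanish at gamma.
   So D has a nontrivial motion, which splits D into smaller classes; iterating, with
   motions of higher and higher order in t, one gets polynomial normals h_H(t) which
   are pairwise independent for generic t, and such that gamma extends to a curve
   gamma(t) with gamma_p(t) orthogonal to h_H(t) for all p in H.  Thus gamma is in the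
   closure of the realization space, and the Nullstellensatz concludes. *)

Require Import Defs.
From HB Require Import structures.
From mathcomp Require Import all_boot all_order all_algebra.
From mathcomp Require Import classical_sets cardinality reals complex mpoly.
From mathcomp Require Import boolp perm zify ring lra.
(* last, so that set0, subsetP and the like refer to {set T} *)
From mathcomp Require Import fintype finset.

Set Implicit Arguments.
Unset Strict Implicit.
Unset Printing Implicit Defensive.

Import Order.TTheory GRing.Theory Num.Theory.
Local Open Scope ring_scope.

(** * Determinants and collections of cycles *)

Section CyclesOfPermutations.
Variables (E : finType) (k : nat) (p : 'I_k -> E) (c : 'I_k -> seq E).
Implicit Types s : 'S_k.

Definition orbit_graph s (O : {set 'I_k}) : {set 'I_k * 'I_k} :=
  [set (i, s i) | i in O].

Definition nontrivial_orbits s : {set {set 'I_k}} :=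
  [set porbit s i | i in [set i | s i != i]].

(** The nontrivial cycles of [s] as edge sets, the encoding used by [cycle_collections]. *)
Definition perm_cycles s : {set {set 'I_k * 'I_k}} :=
  [set orbit_graph s O | O in nontrivial_orbits s].

(** Only these permutations contribute to the determinant: any other one has a zero factor. *)
Definition edge_perm s := [forall i, (s i != i) ==> edge p c i (s i)].

Lemma cycle_vertices_orbit_graph s O : cycle_vertices (orbit_graph s O) = O.
Proof.
apply/setP=> i; apply/imsetP/idP => [[a /imsetP[j jO ->] ->] //|iO].
by exists (i, s i) => //; apply: imset_f.
Qed.

Lemma porbit_fix s i j : j \in porbit s i -> (s j == j) = (s i == i).
Proof.
move=> /porbitP[m ->]; rewrite -permM -expgSr expgS permM.
by apply/inj_eq/perm_inj.
Qed.

Lemma cover_perm_cycles s : cover (perm_cycles s) = orbit_graph s [set i | s i != i].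
Proof.
apply/setP=> a; apply/bigcupP/imsetP=> [[Z]|[i ns ->]].
  case/imsetP=> O /imsetP[x ns ->] -> /imsetP[j jO ->]; exists j => //.
  by move: ns; rewrite !inE (porbit_fix jO).
exists (orbit_graph s (porbit s i)); first by rewrite !imset_f.
by rewrite imset_f // porbit_id.
Qed.

Lemma cycle_vertices_perm_cycles s :
  cycle_vertices (cover (perm_cycles s)) = [set i | s i != i].
Proof. by rewrite cover_perm_cycles cycle_vertices_orbit_graph. Qed.

(** The cover of [perm_cycles s] is the graph of [s] on its moved points, which determines [s]. *)
Lemma perm_cycles_inj : injective perm_cycles.
Proof.
move=> s t eq_st; apply/permP=> i.
have eq_cov : orbit_graph s [set i | s i != i] = orbit_graph t [set i | t i != i].
  by rewrite -!cover_perm_cycles eq_st.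
have aux u v : orbit_graph u [set i | u i != i] = orbit_graph v [set i | v i != i] ->
    u i != i -> u i = v i.
  move=> e ui; have: (i, u i) \in orbit_graph u [set i | u i != i].
    by rewrite imset_f // inE.
  by rewrite e => /imsetP[j _ [-> ->]].
have [si|si] := eqVneq (s i) i; last exact: aux.
have [ti|ti] := eqVneq (t i) i; last by apply/esym/aux.
by rewrite si ti.
Qed.

Lemma card_perm_cycles s : #|perm_cycles s| = #|nontrivial_orbits s|.
Proof.
by rewrite card_imset // => A B /(congr1 (@cycle_vertices k));
  rewrite !cycle_vertices_orbit_graph.
Qed.

(** The parity of [s] is that of [k] plus the number of its orbits. A fixed point counts once in [k]
    and once as a singleton orbit, so the fixed points cancel. *)
Lemma sign_perm_cycles s :
  odd_perm s = odd (#|[set i | s i != i]| + #|perm_cycles s|).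
Proof.
have fixE : porbits s = nontrivial_orbits s :|: [set [set i] | i in [set i | s i == i]].
  apply/setP=> O; rewrite inE; apply/imsetP/orP => [[i _ ->]|].
    have [si|si] := eqVneq (s i) i.
      right; apply/imsetP; exists i; rewrite ?inE ?si //.
      apply/setP=> j; rewrite inE; apply/idP/eqP=> [/porbitP[m ->]|->]; last exact: porbit_id.
      by elim: m => [|m IH]; rewrite ?expg0 ?perm1 // expgSr permM IH.
    by left; rewrite imset_f // inE.
  case=> OP; have [i si ->] := imsetP OP; first by exists i.
  exists i => //; move: si; rewrite inE => /eqP si.
  apply/setP=> j; rewrite inE; apply/eqP/idP=> [->|/porbitP[m ->]]; first exact: porbit_id.
  by elim: m => [|m IH]; rewrite ?expg0 ?perm1 // expgSr permM IH.
have disj : [disjoint nontrivial_orbits s & [set [set i] | i in [set i | s i == i]]].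
  apply/pred0Pn => -[O /= /andP[/imsetP[i ns ->] /imsetP[j js eqO]]].
  have : j \in porbit s i by rewrite eqO set11.
  by move=> /porbit_fix; move: ns js; rewrite !inE => /negPf -> ->.
rewrite /odd_perm fixE cardsU (disjoint_setI0 disj) cards0 subn0.
rewrite (card_imset _ set1_inj) card_perm_cycles.
rewrite -(cardsC [set i | s i == i]).
have -> : ~: [set i | s i == i] = [set i | s i != i].
  by apply/setP=> i; rewrite !inE.
rewrite !oddD.
by do 3 case: (odd _).
Qed.

Lemma traject_porbit_cycle s i :
  fcycle s (traject s i #|porbit s i|).
Proof.
have := iter_porbit s i; have := card_porbit_neq0 s i.
case: #|_| => // m _ /= e.
rewrite rcons_path fpath_traject /= last_traject; apply/eqP.
by rewrite -{2}e.
Qed.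

Lemma perm_cycles_collection s : edge_perm s ->
  (perm_cycles s == set0) || (perm_cycles s \in cycle_collections p c).
Proof.
move=> /forallP es; case: eqP => //= /eqP n0; rewrite inE n0 /=.
apply/andP; split.
  apply/forallP=> Z; apply/implyP=> /imsetP[O /imsetP[i ns ->] ->].
  set t := traject s i #|porbit s i|.
  have tO : t =i porbit s i by move=> x; rewrite porbit_traject.
  have szt : size t = #|porbit s i| by rewrite size_traject.
  have ltk : (#|porbit s i| < k.+1)%N by rewrite ltnS -[X in (_ <= X)%N]card_ord max_card.
  apply/existsP; exists (Ordinal ltk); apply/existsP.
  have szt' : size t == Ordinal ltk by rewrite szt.
  exists (Tuple szt') => /=.
  have ut : uniq t by exact: uniq_traject_porbit.
  apply/and4P; split=> //.
  - by rewrite lt0n card_porbit_neq0.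
  - have fc : fcycle s t by exact: traject_porbit_cycle.
    apply/(cycle_from_next ut) => x xt.
    rewrite (nextE fc xt); apply: (implyP (es x)).
    by move: xt ns; rewrite tO inE => /porbit_fix ->.
  - apply/eqP; rewrite /orbit_graph.
    have fc : fcycle s t by exact: traject_porbit_cycle.
    apply/setP=> a; apply/imsetP/imsetP => -[x xt ->]; exists x.
    + by rewrite /= tO.
    + by rewrite (nextE fc) // tO.
    + by rewrite -tO.
    + by rewrite (nextE fc xt).
apply/forallP=> Z1; apply/implyP=> /imsetP[O1 /imsetP[i1 ns1 ->] ->].
apply/forallP=> Z2; apply/implyP=> /imsetP[O2 /imsetP[i2 ns2 ->] ->].
apply/implyP; rewrite !cycle_vertices_orbit_graph => neq.
apply/pred0Pn => -[x /= /andP[]]; rewrite -!eq_porbit_mem => /eqP e1 /eqP e2.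
by case/negP: neq; rewrite -e1 -e2.
Qed.

Lemma collection_perm_cycles (C : {set {set 'I_k * 'I_k}}) :
  C \in cycle_collections p c -> exists2 s, edge_perm s & perm_cycles s = C.
Proof.
rewrite inE => /and3P[_ /forallP sC /forallP dC].
have cyc Z : Z \in C -> exists t : seq 'I_k, [/\ cycle (edge p c) t, uniq t, t != [::] &
    Z = [set (i, next t i) | i in t]].
  move=> ZC; have /existsP[m /existsP[t /and4P[m0 ct ut /eqP Zt]]] := implyP (sC Z) ZC.
  by exists t; split=> //; rewrite -size_eq0 size_tuple -lt0n.
have disj Z1 Z2 x : Z1 \in C -> Z2 \in C -> x \in cycle_vertices Z1 ->
    x \in cycle_vertices Z2 -> Z1 = Z2.
  move=> Z1C Z2C x1 x2; apply/eqP; apply: contraT => neq.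
  have := implyP (forallP (implyP (dC Z1) Z1C) Z2) Z2C => /implyP/(_ neq).
  by move/pred0P/(_ x); rewrite /= x1 x2.
have vert t : cycle_vertices [set (i, next t i) | i in t] = [set i in t].
  apply/setP=> x; rewrite inE; apply/imsetP/idP=> [[a /imsetP[y yt ->] ->] //|xt].
  by exists (x, next t x) => //; apply: imset_f.
(* The permutation follows the edge of the collection that leaves [i], and fixes [i] if there is
   none. Disjointness of the cycles makes this edge unique and [f] injective. *)
pose f i := if [pick j | (i, j) \in cover C] is Some j then j else i.
have fZ Z t i : Z \in C -> Z = [set (i, next t i) | i in t] -> i \in t -> f i = next t i.
  move=> ZC Zt it; rewrite /f; case: pickP => [j|/(_ (next t i))]; last first.
    by case/bigcupP; exists Z => //; rewrite Zt; apply: imset_f.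
  case/bigcupP=> Z' Z'C ij.
  have eZ : Z' = Z.
    apply: (disj _ _ i) => //; first by apply/imsetP; exists (i, j).
    by rewrite Zt vert inE.
  by move: ij; rewrite eZ Zt => /imsetP[y yt [-> ->]].
have fN i : i \notin cycle_vertices (cover C) -> f i = i.
  rewrite /f; case: pickP => // j ij /imsetP[]; by exists (i, j).
have covP i : i \in cycle_vertices (cover C) ->
   exists Z t, [/\ Z \in C, Z = [set (i, next t i) | i in t], i \in t,
     uniq t & cycle (edge p c) t].
  case/imsetP=> -[a b] /bigcupP[Z ZC ab] /= ->.
  have [t [ct ut _ Zt]] := cyc _ ZC; exists Z, t; split=> //.
  by move: ab; rewrite Zt => /imsetP[y yt [-> _]].
have fcov i : (f i \in cycle_vertices (cover C)) = (i \in cycle_vertices (cover C)).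
  have [iV|iV] := boolP (i \in cycle_vertices (cover C)); last by rewrite fN // (negPf iV).
  have [Z [t [ZC Zt it ut _]]] := covP _ iV.
  rewrite (fZ Z t) //; apply/imsetP; exists (next t i, next t (next t i)) => //.
  by apply/bigcupP; exists Z => //; rewrite Zt; apply: imset_f; rewrite mem_next.
have inj_f : injective f.
  move=> i j eqf.
  have [iV|iV] := boolP (i \in cycle_vertices (cover C)); last first.
    have jV : j \notin cycle_vertices (cover C) by rewrite -fcov -eqf fcov.
    by move: eqf; rewrite !fN.
  have jV : j \in cycle_vertices (cover C) by rewrite -fcov -eqf fcov.
  have [Z [t [ZC Zt it ut _]]] := covP _ iV.
  have [Z' [t' [ZC' Zt' jt' _ _]]] := covP _ jV.
  have fi := fZ _ _ _ ZC Zt it; have fj := fZ _ _ _ ZC' Zt' jt'.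
  have eZ : Z = Z'.
    apply: (disj _ _ (f i)) => //.
      by rewrite Zt vert inE fi mem_next.
    by rewrite Zt' vert inE eqf fj mem_next.
  have jt : j \in t.
    have: j \in [set i in t'] by rewrite inE.
    by rewrite -vert -Zt' -eZ Zt vert inE.
  apply: (can_inj (prev_next ut)).
  by rewrite -fi eqf (fZ Z t).
pose s : 'S_k := perm inj_f.
have sE i : s i = f i by rewrite permE.
have nfix i : (s i != i) = (i \in cycle_vertices (cover C)).
  rewrite sE; have [iV|iV] := boolP (i \in cycle_vertices (cover C)); last first.
    by rewrite fN // eqxx.
  have [Z [t [ZC Zt it ut ct]]] := covP _ iV.
  rewrite (fZ Z t) //; by have /andP[] := next_cycle ct it.
have orb Z t i : Z \in C -> Z = [set (i, next t i) | i in t] -> uniq t -> i \in t ->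
    orbit_graph s (porbit s i) = Z.
  move=> ZC Zt ut it.
  have fct : fcycle s t.
    by apply/(cycle_from_next ut) => x xt /=; rewrite sE (fZ Z t) //.
  have pE : porbit s i =i t.
    move=> x; rewrite porbit_traject -(fconnect_cycle fct it).
    apply/trajectP/idP => [[m _ ->]|]; first exact: fconnect_iter.
    move=> /iter_findex xE.
    have /porbitP[m] : x \in porbit s i by rewrite -xE -permX mem_porbit.
    move=> xm; have : x \in porbit s i by rewrite xm mem_porbit.
    by rewrite porbit_traject => /trajectP.
  apply/setP=> a; rewrite Zt; apply/imsetP/imsetP => -[x xt ->]; exists x => //.
  - by rewrite /= -pE.
  - by rewrite sE (fZ Z t) // -pE.
  - by rewrite pE.
  - by rewrite sE (fZ Z t).
exists s.
  apply/forallP=> i; apply/implyP; rewrite nfix => /covP[Z [t [ZC Zt it ut ct]]].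
  by rewrite sE (fZ Z t) //; apply: next_cycle.
apply/setP=> Z; apply/imsetP/idP => [[O OP ->]|ZC].
  have [i + ->] := imsetP OP; rewrite inE nfix => /covP[Z' [t [ZC Zt it ut ct]]].
  by rewrite (orb Z' t).
have [t [ct ut t0 Zt]] := cyc _ ZC.
have [i it] : exists i, i \in t by case: (t) t0 => // i u _; exists i; rewrite mem_head.
exists (porbit s i); last by rewrite (orb Z t).
rewrite imset_f // inE nfix; apply/imsetP; exists (i, next t i) => //.
by apply/bigcupP; exists Z => //; rewrite Zt; apply: imset_f.
Qed.

(* A nontrivial cycle of length m of a permutation contributes (-1)^(m-1) through the
   signature and (-1)^m through its m entries [- w i j], that is -1 in total. *)
Lemma det_cycle_collections (A : comNzRingType) (d : 'I_k -> A) (w : 'I_k -> 'I_k -> A) :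
  \det (\matrix_(i, j) if j == i then d i else if edge p c i j then - w i j else 0) =
  \prod_(i < k) d i +
  \sum_(C in cycle_collections p c) (-1) ^+ #|C| *
    (\prod_(a in cover C) w a.1 a.2) *
    (\prod_(i < k | i \notin cycle_vertices (cover C)) d i).
Proof.
pose G (C : {set {set 'I_k * 'I_k}}) : A := (-1) ^+ #|C| *
    (\prod_(a in cover C) w a.1 a.2) *
    (\prod_(i < k | i \notin cycle_vertices (cover C)) d i).
(* The product of all [d i] is the term of the empty collection, which [cycle_collections] excludes
   and which corresponds to the identity permutation. *)
have G0 : \prod_(i < k) d i = G set0.
  rewrite /G cards0 expr0 mul1r /cover !big_set0 mul1r.
  by apply: eq_bigl => i; rewrite /cycle_vertices imset0 inE.
rewrite G0 -[X in _ + X]/(\sum_(C in cycle_collections p c) G C) -big_setU1; last first.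
  by rewrite inE eqxx.
have -> : set0 |: cycle_collections p c = [set perm_cycles s | s in edge_perm].
  apply/setP=> C; rewrite in_setU1; apply/idP/imsetP=> [/orP[/eqP->|]|[s es ->]].
  - exists 1%g; first by apply/forallP=> i; rewrite perm1 eqxx.
    have n0 : nontrivial_orbits 1 = set0.
      apply/setP=> O; rewrite inE; apply/negP=> OP; case: (imsetP OP) => i.
      by rewrite inE perm1 eqxx.
    by rewrite /perm_cycles n0 imset0.
  - by case/collection_perm_cycles=> s es <-; exists s.
  - exact: perm_cycles_collection.
rewrite big_imset /=; last by move=> s t _ _; apply: perm_cycles_inj.
rewrite /determinant (bigID (fun s : 'S_k => edge_perm s)) /= [X in _ + X]big1 ?addr0;
  last first.
  move=> s; case/forallPn=> i; rewrite negb_imply => /andP[si ei].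
  by rewrite (bigD1 i) //= mxE (negPf si) (negPf ei) mul0r mulr0.
apply: eq_bigr => s es; rewrite /G cycle_vertices_perm_cycles cover_perm_cycles.
rewrite (bigID (fun i => s i != i)) /=.
rewrite (eq_bigr (fun i => (-1) * w i (s i))); last first.
  by move=> i si; rewrite mxE (negPf si) (implyP (forallP es i) si) mulN1r.
rewrite big_split /= prodr_const.
rewrite [X in _ * (_ * X)](eq_bigr d); last first.
  by move=> i; rewrite negbK mxE => ->.
rewrite big_imset /=; last by move=> i j _ _ [].
rewrite !mulrA; congr (_ * _ * _); last by apply: eq_bigl => i; rewrite inE.
  by rewrite sign_perm_cycles signr_odd exprD cardsE mulrAC -expr2 sqrr_sign mul1r.
by apply: eq_bigl => i; rewrite inE.
Qed.

End CyclesOfPermutations.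

Lemma ideal_sum (A : comNzRingType) (I : set A) (T : Type) (r : seq T) (P : pred T)
    (F : T -> A) : is_ideal I -> (forall i, P i -> I (F i)) -> I (\sum_(i <- r | P i) F i).
Proof. by case=> I0 ID _ IF; elim/big_rec: _ => // i x Pi Ix; apply: ID => //; apply: IF. Qed.

(* By Laplace expansion along the columns outside [B]. *)
Lemma det_ideal_columns (A : comNzRingType) (I : set A) (X : Type) (T : finType)
    (Y : X -> T -> A) (B : {set T}) : is_ideal I ->
  (forall (f : 'I_#|B| -> X) (g : 'I_#|B| -> T), injective g ->
    [set g i | i in 'I_#|B|] = B -> I (\det (\matrix_(i, j) Y (f i) (g j)))) ->
  forall r (f : 'I_r -> X) (g : 'I_r -> T), injective g ->
    B \subset [set g i | i in 'I_r] -> I (\det (\matrix_(i, j) Y (f i) (g j))).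
Proof.
move=> idI IB; elim=> [|r IH] f g inj_g sB.
  have B0 : #|B| = 0%N.
    apply/eqP; rewrite -leqn0 -[X in (_ <= X)%N](card_ord 0) -(card_imset _ inj_g).
    exact: subset_leq_card.
  move: (IB); rewrite B0 => /(_ f g inj_g); apply.
  apply/eqP; rewrite eq_sym eqEcard sB (card_imset _ inj_g) card_ord B0 leqnn //.
have cardg : #|[set g i | i in 'I_r.+1]| = r.+1 by rewrite (card_imset _ inj_g) card_ord.
have [/eqP eB|] := boolP (B == [set g i | i in 'I_r.+1]).
  have cB : #|B| = r.+1 by rewrite eB.
  by move: (IB); rewrite cB => /(_ f g inj_g); apply.
move=> neB; have : B \proper [set g i | i in 'I_r.+1] by rewrite properEneq neB.
case/properP=> _ [_ /imsetP [j _ ->] gjB].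
rewrite (expand_det_col _ j); apply: ideal_sum => // i _; rewrite mxE.
case: (idI) => _ _ IM; apply: (IM); rewrite /cofactor; apply: (IM).
have -> : row' i (col' j (\matrix_(i0, j0) Y (f i0) (g j0))) =
          \matrix_(i0, j0) Y ((f \o lift i) i0) ((g \o lift j) j0).
  by apply/matrixP=> a b; rewrite !mxE.
apply: IH; first exact: inj_comp inj_g (@lift_inj _ j).
apply/subsetP=> x xB; have /imsetP [a _ xa] := subsetP sB _ xB.
case: (unliftP j a) => [b ab|aj]; last by rewrite xa aj (negPf gjB) in xB.
by rewrite xa ab; apply/imsetP; exists b.
Qed.

(** * Determinants given by a list of columns *)

Section ColumnDeterminants.
Variables (A : comNzRingType) (n : nat).
Implicit Types (q : 'cV[A]_n).

(** The sign is chosen before [v], so that it is the same whichever column of the list gets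
    replaced. *)
Lemma det_cols_perm (T : eqType) (s t : seq T) : perm_eq s t -> size t = n ->
  exists b : bool, forall v : T -> 'cV[A]_n,
    det_cols (map v s) = (-1) ^+ b * det_cols (map v t).
Proof.
move=> st szt; have szt' : size t == n by rewrite szt.
have /tuple_permP [s0 sE] : perm_eq s (Tuple szt') by [].
exists (odd_perm s0) => v; rewrite /det_cols mulrC -det_perm.
have -> : \matrix_(i < n, j < n) (map v s)`_j i 0 =
    col_perm s0 (\matrix_(i < n, j < n) (map v t)`_j i 0).
  apply/matrixP=> i j; rewrite !mxE; congr (_ _ i 0).
  have x0 := tnth (Tuple szt') j.
  rewrite sE (nth_map x0) ?size_tuple // (nth_map x0) ?szt //.
  by rewrite -tnth_nth tnth_mktuple (tnth_nth x0).
by rewrite col_permE det_mulmx !det_perm odd_permV.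
Qed.

Lemma det_cols_rot (a b : seq 'cV[A]_n) (x : 'cV[A]_n) : (size a + size b).+1 = n ->
  det_cols (a ++ x :: b) = (-1) ^+ size b * det_cols (a ++ b ++ [:: x]).
Proof.
elim: b a => [|y b IH] a sz; first by rewrite expr0 mul1r.
have -> : det_cols (a ++ x :: y :: b) = - det_cols ((a ++ [:: y]) ++ x :: b).
  rewrite -catA cat1s /det_cols.
  have sza : (size a < n)%N by apply: leq_trans (eq_leq sz); rewrite ltnS leq_addr.
  have sza' : ((size a).+1 < n)%N by apply: leq_trans (eq_leq sz);
    rewrite ltnS /= addnS ltnS leq_addr.
  have -> : \matrix_(i < n, j < n) (a ++ [:: x, y & b])`_j i 0 =
      xcol (Ordinal sza) (Ordinal sza') (\matrix_(i < n, j < n) (a ++ [:: y, x & b])`_j i 0).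
    apply/matrixP=> i j; rewrite !mxE; congr (_ _ i 0).
    case: tpermP => [->|->|/eqP + /eqP]; rewrite ?nth_cat /= ?ltnn ?subnn //.
    - by rewrite ltnNge leqnSn /= subSn // subnn.
    - by rewrite ltnNge leqnSn /= subSn // subnn.
    rewrite -!val_eqE /= => j1 j2; case: ltnP => // leaj.
    have [m ->] : exists m, (j - size a)%N = m.+2.
      exists (j - size a).-2; case: (j - size a)%N (subnKC leaj) => [|[|m]] // e.
        by rewrite -e addn0 eqxx in j1.
      by rewrite -e addn1 eqxx in j2.
    by [].
  rewrite xcolE det_mulmx det_perm odd_tperm -val_eqE /= neq_ltn ltnSn expr1 mulrN1 //.
rewrite IH; last by rewrite size_cat /= addn1 -[RHS]sz /= addnS.
by rewrite exprS mulN1r mulNr -catA.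
Qed.

(** Moving [q] from the place of [p] to the last place absorbs the sign of that place; the sign that
    remains depends only on [n]. *)
Lemma det_cols_rem (T : eqType) (v : T -> 'cV[A]_n) q (s : seq T) p :
  uniq s -> size s = n -> p \in s ->
  (-1) ^+ index p s * det_cols (map v (rem p s) ++ [:: q]) =
  (-1) ^+ n.-1 * det_cols [seq if x == p then q else v x | x <- s].
Proof.
move=> us sz ps; case/splitPr: ps us sz => s1 s2.
rewrite cat_uniq /= negb_or => /and4P [_ /andP [p1 _] p2 _].
rewrite size_cat /= addnS => sz.
rewrite index_cat (negPf p1) /= eqxx addn0.
have -> : rem p (s1 ++ p :: s2) = s1 ++ s2.
  by rewrite remE index_cat (negPf p1) /= eqxx addn0 take_size_cat // drop_cat ltnNge
    leqnSn /= subSn // subnn /= drop0.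
rewrite !map_cat /= eqxx.
have mapN (t : seq T) : p \notin t -> [seq if x == p then q else v x | x <- t] = map v t.
  by move=> pt; apply/eq_in_map => x xt; case: eqP => // xp; rewrite -xp xt in pt.
rewrite !mapN // [in RHS]det_cols_rot ?size_map // mulrA -exprD.
have -> : (n.-1 + size s2 = size s1 + (size s2).*2)%N by rewrite -sz /= -addnA addnn.
by rewrite exprD -mul2n exprM sqrrN expr1n expr1n mulr1 catA.
Qed.

(** By expansion along the replaced column, the determinants on the left are the entries of adj(A)
    q, where A is the matrix of the vectors of [s] (Cramer's rule). *)
Lemma det_cols_replace (T : eqType) (v : T -> 'cV[A]_n) q (s : seq T) (z : T -> A) :
  uniq s -> size s = n -> forall x0,
  \sum_(x <- s) z x * det_cols [seq if y == x then q else v y | y <- s] =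
  ((\row_(j < n) z (nth x0 s j)) *m \adj (\matrix_(i < n, j < n) v (nth x0 s j) i 0) *m q) 0 0.
Proof.
move=> us sz x0; rewrite -mulmxA mxE (big_nth x0) sz big_mkord; apply: eq_bigr => j _.
rewrite !mxE; congr (_ * _); rewrite /det_cols (expand_det_col _ j).
apply: eq_bigr => i _; rewrite !mxE (nth_map x0) ?sz // eqxx mulrC; congr (_ * _).
rewrite /cofactor; congr (_ * \det _); apply/matrixP=> a b; rewrite !mxE.
rewrite (nth_map x0) ?sz // nth_uniq ?sz //.
by have := neq_lift j b; rewrite eq_sym -val_eqE => /negPf ->.
Qed.

End ColumnDeterminants.

Lemma det_scale_rows (A : comNzRingType) (k : nat) (a : 'I_k -> A) (Y : 'I_k -> 'I_k -> A) :
  \det (\matrix_(i, j) (a i * Y i j)) = (\prod_i a i) * \det (\matrix_(i, j) Y i j).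
Proof.
have -> : \matrix_(i, j) (a i * Y i j) =
    diag_mx (\row_i a i) *m (\matrix_(i, j) Y i j).
  by apply/matrixP=> i j; rewrite mul_diag_mx !mxE.
by rewrite det_mulmx det_diag; congr (_ * _); apply: eq_bigr => i _; rewrite mxE.
Qed.

Lemma subset_closure (E : finType) (M : matroid E) (J : {set E}) :
  J \subset matroid_closure M J.
Proof.
apply/fintype.subsetP=> x xJ; rewrite inE; apply/eqP; congr (rank M _).
by apply/setUidPr; rewrite sub1set.
Qed.

(** * Graph polynomials as determinants *)

Section CircuitRows.
Variables (K : fieldType) (n : nat) (E : finType) (M : matroid E).
Local Notation ring := {mxpoly K[n, E]}.

(** The common form of the rows of liftability matrices and of the matrices whose determinants are
    the graph polynomials, with columns indexed by all of [E]. *)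
Definition circuit_row (s : seq E) (q : 'cV[K]_n) (x : E) : ring :=
  if x \in s then (-1) ^+ index x s * bracket (rem x s) [:: q] else 0.

Lemma circuit_row_replace s q x : uniq s -> size s = n -> x \in s ->
  circuit_row s q x =
  (-1) ^+ n.-1 * det_cols [seq if y == x then const_col E q else generic_col K n y | y <- s].
Proof.
by move=> us sz xs; rewrite /circuit_row xs /bracket -det_cols_rem.
Qed.

Lemma circuit_row_perm s t q : perm_eq s t -> uniq t -> size t = n ->
  exists b : bool, forall x, circuit_row s q x = (-1) ^+ b * circuit_row t q x.
Proof.
move=> st ut szt; have [b bP] := @det_cols_perm ring n _ s t st szt.
exists b => x; have [xs|xs] := boolP (x \in s); last first.
  by rewrite /circuit_row -(perm_mem st) (negPf xs) mulr0.
rewrite !circuit_row_replace -?(perm_uniq st) -?(perm_size st) -?(perm_mem st) //;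
  rewrite ?(perm_uniq st) ?(perm_size st) // .
by rewrite mulrCA bP.
Qed.

(** The diagonal entries are the vertex weights because [p i] heads [c i]. Off the diagonal, the
    shift from 0-based to 1-based positions is the sign in the entries [- w i j] of
    [det_cycle_collections]. *)
Lemma graph_polynomial_det (k : nat) (p : 'I_k -> E) (c : 'I_k -> seq E)
    (q : 'I_k -> 'cV[K]_n) : injective p -> (forall i, ohead (c i) = Some (p i)) ->
  graph_polynomial p c q = \det (\matrix_(i, j) circuit_row (c i) (q i) (p j)).
Proof.
move=> inj_p hc; rewrite /graph_polynomial -det_cycle_collections.
congr (\det _); apply/matrixP=> i j; rewrite !mxE /circuit_row.
have [->|ji] := eqVneq j i.
  rewrite /vertex_weight; case: (c i) (hc i) => // x s [->].
  by rewrite mem_head /= eqxx expr0 mul1r.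
rewrite /edge /= ji /=; case: ifP => // _.
by rewrite /edge_weight exprS mulN1r mulNr opprK.
Qed.

(** A nonzero term of the determinant is a matching of the rows with points of their circuits.
    Permuting the rows along it and reordering each circuit gives an admissible choice, at the cost
    of a sign. *)
Lemma det_circuit_rows (J : {set E}) (k : nat) (p : 'I_k -> E) (s : 'I_k -> seq E) q :
  (0 < k)%N -> injective p ->
  [disjoint [set p i | i in 'I_k] & matroid_closure M J] ->
  (forall i, [/\ circuit M [set x in s i], uniq (s i), size (s i) = n &
     [set x in s i] \subset [set p i | i in 'I_k] :|: J]) ->
  \det (\matrix_(i, j) circuit_row (s i) q (p j)) = 0 \/
  exists (c : 'I_k -> seq E) (b : bool), graph_choice n M J p c /\
    \det (\matrix_(i, j) circuit_row (s i) q (p j)) =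
    (-1) ^+ b * graph_polynomial p c (fun=> q).
Proof.
move=> k0 inj_p; set P := [set p i | i in 'I_k] => dPJ sP.
have [/existsP [t /forallP tP]|] := boolP [exists t : 'S_k, [forall i, p (t i) \in s i]];
  last first.
  rewrite negb_exists => /forallP nt; left; rewrite /determinant big1 // => t _.
  have /existsP [i it] : [exists i, p (t i) \notin s i] by rewrite -negb_forall nt.
  by rewrite (bigD1 i) //= mxE /circuit_row (negPf it) mul0r mulr0.
(* Reindexed along the matching, the circuit [u i] contains [p i], so it can be listed with [p i]
   first, then the rest of [P], then the other points. *)
right; pose u i := s ((t^-1)%g i).
pose c i := p i :: [seq x <- u i | (x \in P) && (x != p i)] ++ [seq x <- u i | x \notin P].
have pu i : p i \in u i by have := tP ((t^-1)%g i); rewrite permKV.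
have uu i : uniq (u i) by have [_] := sP ((t^-1)%g i).
have uc i : uniq (c i).
  rewrite /c /= mem_cat !mem_filter eqxx andbF imset_f //= cat_uniq !filter_uniq //= andbT.
  by apply/hasPn => x; rewrite !mem_filter => /andP [/negPf ->].
have mc i : c i =i u i.
  move=> x; rewrite inE mem_cat !mem_filter.
  have [->|] := eqVneq x (p i); first by rewrite pu.
  by rewrite andbT -andb_orl orbN.
have pc i : perm_eq (u i) (c i) by apply: uniq_perm => // x; rewrite mc.
have szc i : size (c i) = n by rewrite -(perm_size (pc i)); have [_ _ ->] := sP ((t^-1)%g i).
have /fin_all_exists [b bP] : forall i, exists b : bool, forall x,
    circuit_row (u i) q x = (-1) ^+ b * circuit_row (c i) q x.
  by move=> i; apply: circuit_row_perm.
have setc i : [set x in c i] = [set x in u i] by apply/setP=> x; rewrite !in_set mc.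
(* One sign for the permutation of the rows and one for each reordered circuit. *)
exists c, (odd_perm t (+) odd (\sum_i b i)); split.
  split=> // i; have [ci _ _ si] := sP ((t^-1)%g i); split; split=> //.
  - by rewrite setc.
  - by rewrite setc.
  move=> x y xc yc xP yJ.
  have yP : y \notin P.
    apply: contraL dPJ => yP; apply/pred0Pn; exists y; rewrite /= yP /=.
    exact: fintype.subsetP (subset_closure M J) _ yJ.
  have px z : z \notin P -> p i != z by apply: contraNneq => <-; rewrite imset_f.
  rewrite /c /=; have [//|xpi] := eqVneq (p i) x; first by rewrite (negPf (px _ yP)).
  rewrite (negPf (px _ yP)) ltnS !index_cat !mem_filter xP (negPf yP) /=.
  have xu : x \in u i by rewrite -mc.
  rewrite eq_sym xpi xu; apply: leq_trans (leq_addr _ _).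
  by rewrite index_mem mem_filter xP eq_sym xpi.
rewrite graph_polynomial_det // signr_addb signr_odd -mulrA.
have -> : (-1) ^+ (\sum_i b i) * \det (\matrix_(i, j) circuit_row (c i) q (p j)) =
    \det (\matrix_(i, j) circuit_row (u i) q (p j)) :> ring.
  rewrite expr_sum -det_scale_rows; congr (\det _); apply/matrixP=> i j.
  by rewrite !mxE bP.
rewrite -det_perm -det_mulmx; congr (\det _).
have -> : perm_mx t *m (\matrix_(i, j) circuit_row (u i) q (p j)) =
    row_perm t (\matrix_(i, j) circuit_row (u i) q (p j)) by rewrite row_permE.
by apply/matrixP=> i j; rewrite !mxE /u permK.
Qed.

End CircuitRows.

(** * The lifting ideal *)

Section MatroidRank.
Variables (E : finType) (M : matroid E).
Implicit Types (A B C J H : {set E}).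

Lemma indep_leq_rank A B : B \subset A -> indep M B -> (#|B| <= rank M A)%N.
Proof.
move=> sBA iB.
by apply: (@leq_bigmax_cond _ (fun B : {set E} => (B \subset A) && indep M B) (fun B =>
  #|B|)); rewrite sBA.
Qed.

Lemma rank_indep A : exists B, [/\ B \subset A, indep M B & #|B| = rank M A].
Proof.
have [|B /andP [sB iB] eB] := @eq_bigmax_cond _
    [pred B : {set E} | (B \subset A) && indep M B] (fun B => #|B|).
  by apply/card_gt0P; exists set0; rewrite inE sub0set indep_set0.
by exists B.
Qed.

Lemma rank_leq_card A : (rank M A <= #|A|)%N.
Proof. by have [B [sB _ <-]] := rank_indep A; apply: subset_leq_card. Qed.

Lemma rankS A B : A \subset B -> (rank M A <= rank M B)%N.
Proof.
move=> sAB; have [C [sC iC <-]] := rank_indep A.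
by apply: indep_leq_rank => //; apply: subset_trans sAB.
Qed.

(** Otherwise a basis of [J] could be augmented by a point of [A], which lies in the closure of [J]
    and so cannot raise the rank. *)
Lemma rank_closure A J : A \subset matroid_closure M J -> (rank M A <= rank M J)%N.
Proof.
move=> sA; rewrite leqNgt; apply/negP.
have [C [sC iC <-]] := rank_indep A; have [B [sB iB eB]] := rank_indep J.
rewrite -eB => ltBC; have [x /setDP [xC xB] ixB] := indep_aug iB iC ltBC.
have := fintype.subsetP sA x (fintype.subsetP sC x xC); rewrite inE => /eqP eqr.
have : (#|x |: B| <= rank M (x |: J))%N by apply: indep_leq_rank => //; apply: setUS.
by rewrite eqr cardsU1 xB -eB ltnn.
Qed.

(** A form of the idempotence of the closure. *)
Lemma closure_sub A J : J \subset A -> A \subset matroid_closure M J ->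
  matroid_closure M A \subset matroid_closure M J.
Proof.
move=> sJA sA; apply/fintype.subsetP=> x; rewrite !inE => /eqP eqr.
rewrite eqn_leq [X in _ && X]rankS ?subsetUr // andbT.
have := rank_closure sA; rewrite -eqr; apply: leq_trans.
by apply: rankS; apply: setUS.
Qed.

Lemma circuitP C : reflect (~~ indep M C /\ forall A, A \proper C -> indep M A) (circuit M C).
Proof.
apply: (iffP minsetP) => -[dC mC]; split=> // A.
  move=> pA; apply: contraT => dA; move: (pA).
  by rewrite (mC A dA (proper_sub pA)) properxx.
move=> dA sA; apply/eqP; rewrite eqEproper sA /=.
by apply: contra dA; apply: mC.
Qed.

Lemma dependent_circuit A : ~~ indep M A -> exists2 C, circuit M C & C \subset A.
Proof.
move=> dA; have [C mC sC] := @minset_exists _ (fun D => ~~ indep M D) A dA.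
by exists C.
Qed.

End MatroidRank.

Lemma circuit_restriction (E : finType) (M : matroid E) (S : {set E})
    (C : {set {x : E | x \in S}}) :
  circuit (restriction M S) C -> circuit M [set val x | x in C].
Proof.
move=> /circuitP [dC pC]; apply/circuitP; split=> // A pA.
pose A' : {set {x : E | x \in S}} := [set x | val x \in A].
have AE : A = [set val x | x in A'].
  apply/setP=> x; apply/idP/imsetP=> [xA|[y + ->]]; last by rewrite inE.
  have /imsetP [y yC xy] := fintype.subsetP (proper_sub pA) x xA.
  by exists y => //; rewrite inE -xy.
rewrite AE; apply: (pC A').
case/properP: pA => sA [_ /imsetP [y yC ->] yA]; apply/properP; split; last first.
  by exists y; rewrite // inE.
apply/fintype.subsetP=> x; rewrite inE => /(fintype.subsetP sA) /imsetP [z zC].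
by move=> /val_inj ->.
Qed.

Lemma ideal_genP (A : comNzRingType) (G : set A) : is_ideal (ideal_gen G).
Proof.
split=> [|a b Ia Ib|a b Ib] I [idI sG]; case: (idI) => I0 ID IM //.
  by apply: ID; [apply: Ia | apply: Ib].
by apply: IM; apply: Ib.
Qed.

Lemma mem_ideal_gen (A : comNzRingType) (G : set A) a : G a -> ideal_gen G a.
Proof. by move=> Ga I [_]; apply. Qed.

Lemma ideal_gen_sub (A : comNzRingType) (G I : set A) : is_ideal I ->
  (forall a, G a -> I a) -> forall a, ideal_gen G a -> I a.
Proof. by move=> idI sG a; apply; split. Qed.

Lemma increasing_inj r m (f : 'I_r -> 'I_m) : increasing f -> injective f.
Proof.
move=> inc i j eqf; case: (ltngtP i j) => [/inc|/inc|/val_inj //];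
  by rewrite eqf ltnn.
Qed.

Lemma ideal_sign (A : comNzRingType) (I : set A) (b : bool) a :
  is_ideal I -> I a -> I ((-1) ^+ b * a).
Proof. by case=> _ _ IM; apply: IM. Qed.

Lemma liftability_entry_row (K : fieldType) (n : nat) (E : finType) (S : {set E})
    (q : 'cV[K]_n) (c : {set {x : E | x \in S}}) (x : {x : E | x \in S}) :
  liftability_entry val q c x = circuit_row (map val (enum c)) q (val x).
Proof.
have inj_val : injective (val : {x : E | x \in S} -> E) := val_inj.
have memE : (val x \in map val (enum c)) = (x \in c).
  by rewrite (mem_map inj_val) mem_enum.
have indE : index (val x) (map val (enum c)) = index x (enum c).
  by rewrite index_map.
have remE : rem (val x) (map val (enum c)) = map val (rem x (enum c)).
  elim: (enum c) => //= y s ->; rewrite (inj_eq inj_val).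
  by case: eqP.
by rewrite /liftability_entry /circuit_row memE indE remE.
Qed.

(* The columns of the minor outside the closure of its complement give graph
   polynomials, to which the minor reduces by Laplace expansion. *)
Lemma lift_poly_graph_ideal (K : fieldType) (n : nat) (E : finType) (M : matroid E) f :
  lift_poly K n M f -> graph_ideal K n M f.
Proof.
move=> [S [q [rS [fr [gr [_ inc_g ->]]]]]].
set r := (#|S| - n + 1)%N in fr gr inc_g *.
pose F : finType := {x : E | x \in S}.
have val_injF : injective (val : F -> E) := val_inj.
pose X := 'I_#|ncircuits n (restriction M S)|.
pose Y (i : X) (x : F) := circuit_row (map val (enum (enum_val i : {set F}))) q (val x).
have -> : mxsub fr gr (liftability_mx val (restriction M S) q) =
    \matrix_(i, j) Y (fr i) (enum_val (gr j)).
  apply/matrixP=> i j; rewrite !mxE; exact: liftability_entry_row.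
have idG := @ideal_genP _ (graph_poly K n M).
have inj_g : injective (fun j => enum_val (gr j)).
  by move=> i j /enum_val_inj /(increasing_inj inc_g).
pose P0 := [set enum_val (gr j) | j in 'I_r].
pose J0 := S :\: [set val x | x in P0].
pose B : {set F} := [set x | val x \notin matroid_closure M J0].
have sP0 : [set val x | x in P0] \subset S.
  by apply/fintype.subsetP=> _ /imsetP [x _ ->]; apply: valP.
have lenS : (n <= #|S|)%N by rewrite -rS rank_leq_card.
have cF : #|F| = #|S| by rewrite card_sig; apply: eq_card.
have ler : (r <= #|S|)%N by rewrite -cF -[X in (X <= _)%N]card_ord (leq_card _ inj_g).
(* A minor of size |S| - n + 1 leaves n - 1 points of [S], too few to span a set of rank n. Hence
   [B] is nonempty, as [graph_choice] wants. *)
have cJ0 : (#|J0| < n)%N.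
  rewrite cardsD (setIidPr sP0) (card_imset _ val_injF) (card_imset _ inj_g) card_ord.
  by rewrite ltn_subLR // /r; lia.
apply: (@det_ideal_columns _ _ _ _ Y B) => //; last first.
  apply/fintype.subsetP=> x; rewrite inE; apply: contraR => xP0.
  apply: (fintype.subsetP (subset_closure M J0)); rewrite inE (valP x) andbT.
  by apply/imsetP => -[y yP0 /val_injF xy]; rewrite xy yP0 in xP0.
move=> f' g' inj_g' imB.
(* The points of [S] outside [B]. The closure of [J] is contained in that of [J0], hence it misses
   the points of [B]. *)
pose J := S :&: matroid_closure M J0.
have PE : [set val (g' i) | i in 'I_#|B|] = S :\: matroid_closure M J0.
  apply/setP=> x; rewrite inE; apply/imsetP/andP=> [[i _ ->]|[xJ xS]].
    have : g' i \in B by rewrite -imB imset_f.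
    by rewrite inE => gB; split=> //; apply: (valP (g' i)).
  have xB : (Sub x xS : F) \in B by rewrite inE.
  have /imsetP [i _ ei] : (Sub x xS : F) \in [set g' i | i in 'I_#|B|] by rewrite imB.
  by exists i; rewrite // -ei.
have B0 : (0 < #|B|)%N.
  rewrite card_gt0; apply/eqP=> B0; have : S \subset matroid_closure M J0.
    apply/fintype.subsetP=> x xS; apply: contraT => xJ.
    have : (Sub x xS : F) \in B by rewrite inE.
    by rewrite B0 inE.
  by move=> /rank_closure; rewrite rS => /leq_trans/(_ (rank_leq_card _ _)); rewrite leqNgt cJ0.
have sJ0 : J0 \subset J by rewrite subsetI subsetDl subset_closure.
have clJ : matroid_closure M J \subset matroid_closure M J0.
  by apply: closure_sub; rewrite // subsetIr.
have := @det_circuit_rows K n E M J #|B| (val \o g')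
  (fun i => map val (enum (enum_val (f' i) : {set F}))) q B0.
case=> //.
- exact: inj_comp val_injF inj_g'.
- rewrite PE; apply/pred0P=> x /=; rewrite inE; apply/negP=> /andP [/andP [xJ0 _] xJ].
  by move: xJ0; rewrite (fintype.subsetP clJ).
- move=> i; have := enum_valP (f' i); rewrite inE => /andP [cC /eqP sC].
  have eC : [set x in map val (enum (enum_val (f' i) : {set F}))] = [set val x | x in
    (enum_val (f' i) : {set F})].
    apply/setP=> x; rewrite inE; apply/mapP/imsetP=> -[y yC ->]; exists y => //.
      by rewrite -mem_enum.
    by rewrite mem_enum.
  split.
  + by rewrite eC; apply: circuit_restriction.
  + by rewrite (map_inj_uniq val_injF) enum_uniq.
  + by rewrite size_map -cardE.
  + rewrite PE eC; apply/fintype.subsetP=> _ /imsetP [y yC ->].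
    by rewrite !inE (valP y) /= !andbT orNb.
- by move=> ->; case: idG.
move=> [c [b [gc ->]]]; apply: (ideal_sign b idG); apply: mem_ideal_gen.
by exists J, #|B|, (val \o g'), c, (fun=> q).
Qed.

(** * Nullstellensatz over an uncountable field *)

(* True of every uncountable type; this is the form used by the Nullstellensatz. *)
Definition large_fibre (K : eqType) : Prop := forall h : K -> nat,
  exists d, forall N, exists s : seq K, [/\ uniq s, size s = N & forall a, a \in s -> h a = d].

Section RealUncountable.
Variable R : realType.

Lemma avoid_seq (l : seq R) (a b : R) : a < b ->
  exists a' b', [/\ a <= a', a' < b', b' <= b & forall x, x \in l -> ~~ (a' <= x <= b')].
Proof.
elim: l a b => [|y l IH] a b ab; first by exists a, b; split.
(* The point [y] misses the right third or the left third of the interval. *)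
pose m1 := (2 * a + b) / 3; pose m2 := (a + 2 * b) / 3.
have am1 : a < m1 by rewrite /m1; lra.
have m12 : m1 < m2 by rewrite /m1 /m2; lra.
have m2b : m2 < b by rewrite /m2; lra.
have [ym|ym] := ltP y m2.
  have [a' [b' [h1 h2 h3 h4]]] := IH _ _ m2b; exists a', b'; split=> //; first by lra.
  move=> x; rewrite inE => /orP [/eqP ->|/h4 //].
  by rewrite negb_and -!ltNge; apply/orP; left; lra.
have [a' [b' [h1 h2 h3 h4]]] := IH _ _ am1; exists a', b'; split=> //; first by lra.
move=> x; rewrite inE => /orP [/eqP ->|/h4 //].
by rewrite negb_and -!ltNge; apply/orP; right; lra.
Qed.

(** Cantor's nested intervals: if all fibres were finite, intervals avoiding them one after the
    other would have a common point lying in no fibre. *)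
Lemma real_large_fibre : large_fibre R.
Proof.
move=> h; apply: contrapT => nfib.
have fib d : exists l : seq R, forall x, h x = d -> x \in l.
  have [N nN] : exists N, ~ exists s : seq R, [/\ uniq s, size s = N & forall a,
    a \in s -> h a = d].
    by apply: contrapT => /forallNP nN; apply: nfib; exists d => N; apply: contrapT.
  elim: N nN => [|N IH] nN; first by case: nN; exists [::].
  have [[s [us szs hs]]|] := pselect (exists s : seq R, [/\ uniq s, size s = N & forall a,
    a \in s -> h a = d]); last exact: IH.
  exists s => x hx; apply: contraT => xs; case: nN; exists (x :: s).
  rewrite /= xs us szs; split=> // a; rewrite inE => /orP [/eqP -> //|]; exact: hs.
have [l lP] := choice fib.
have step (d : nat) (ab : R * R) : exists ab' : R * R, ab.1 < ab.2 ->
    [/\ ab.1 <= ab'.1, ab'.1 < ab'.2, ab'.2 <= ab.2 & forall x,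
      x \in l d -> ~~ (ab'.1 <= x <= ab'.2)].
  have [lt|nlt] := boolP (ab.1 < ab.2); last by exists ab.
  by have [a' [b' H]] := avoid_seq (l d) lt; exists (a', b').
have [g gP] := choice (fun u => step u.1 u.2).
pose f d ab := g (d, ab).
have fP d ab : ab.1 < ab.2 ->
    [/\ ab.1 <= (f d ab).1, (f d ab).1 < (f d ab).2, (f d ab).2 <= ab.2 & forall x,
      x \in l d -> ~~ ((f d ab).1 <= x <= (f d ab).2)].
  exact: (gP (d, ab)).
pose J := fix J d := if d is d'.+1 then f d' (J d') else (0 : R, 1 : R).
have Jlt d : (J d).1 < (J d).2.
  by elim: d => [|d IH] /=; [exact: ltr01 | have [] := fP d _ IH].
have Jmono d e : (J d).1 <= (J (d + e)%N).1 /\ (J (d + e)%N).2 <= (J d).2.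
  elim: e => [|e [IH1 IH2]]; first by rewrite addn0.
  have [h1 _ h2 _] := fP (d + e)%N _ (Jlt (d + e)%N); rewrite addnS /=.
  by split; [apply: le_trans h1 | apply: le_trans IH2].
pose S : set R := [set (J d).1 | d in [set: nat]]%classic.
have Jub d : ubound S (J d).2.
  move=> _ [e _ <-]; have [h1 _] := Jmono e d; have [_ h2] := Jmono d e.
  apply: le_trans h1 _; rewrite addnC in h2 *; apply: ltW; apply: lt_le_trans h2.
  by rewrite addnC; apply: Jlt.
have S0 : has_sup S by split; [exists (J 0%N).1, 0%N | exists (J 0%N).2; apply: Jub].
pose x := sup S.
have xJ d : (J d).1 <= x <= (J d).2.
  apply/andP; split; first by apply: ub_le_sup; [case: S0 | exists d].
  by apply: ge_sup; [case: S0 | apply: Jub].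
have [_ _ _ nx] := fP (h x) _ (Jlt (h x)).
by have := nx x (lP (h x) x erefl); have /= -> := xJ (h x).+1.
Qed.

Lemma complex_large_fibre : large_fibre R[i].
Proof.
move=> h; have [d dP] := real_large_fibre (fun x => h (x%:C)%C).
exists d => N; have [s [us szs hs]] := dP N.
exists (map (fun x : R => (x%:C)%C) s); split.
- by rewrite map_inj_uniq // => x y [].
- by rewrite size_map.
- by move=> _ /mapP [x xs ->]; apply: hs.
Qed.

End RealUncountable.

Section Nullstellensatz.

Local Open Scope classical_set_scope.

(** By Zorn's lemma. The last clause is the maximality of [P]: the ideal generated by [P] and [g]
    contains a power of [f]. *)
Lemma maximal_ideal_avoiding_powers (A : comNzRingType) (I : set A) (f : A) :
  is_ideal I -> (forall k, ~ I (f ^+ k)) ->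
  exists P : set A, [/\ is_ideal P, I `<=` P, forall k, ~ P (f ^+ k) &
    forall g, ~ P g -> exists k a, P (f ^+ k - a * g)].
Proof.
move=> idI nI.
(* The empty set is allowed because it is the union of the empty chain. *)
pose Q (X : set A) := X = classical_sets.set0 \/ [/\ is_ideal X, I `<=` X & forall k,
  ~ X (f ^+ k)].
have QU (F : set (set A)) : F `<=` Q -> total_on F classical_sets.subset ->
  Q (\bigcup_(X in F) X).
  move=> FQ Ftot; have [[X0 [FX0 [y Xy]]]|nF] := pselect (exists X, F X /\ X !=set0);
    last first.
    left; rewrite -classical_sets.subset0 => y [X FX Xy]; case: nF; exists X; split=> //;
      by exists y.
  right; have good X z : F X -> X z -> [/\ is_ideal X, I `<=` X & forall k, ~ X (f ^+ k)].
    by move=> FX Xz; have [X0e|//] := FQ X FX; rewrite X0e in Xz.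
  have [idX0 IX0 _] := good _ _ FX0 Xy.
  split.
  - split.
    + by exists X0 => //; case: idX0.
    + move=> a b [X FX Xa] [Y FY Yb].
      have [XY|YX] := Ftot _ _ FX FY.
        by exists Y => //; have [[_ YD _] _ _] := good _ _ FY Yb; apply: YD => //; apply: XY.
      by exists X => //; have [[_ XD _] _ _] := good _ _ FX Xa; apply: XD => //; apply: YX.
    + move=> a b [X FX Xb]; exists X => //.
      by have [[_ _ XM] _ _] := good _ _ FX Xb; apply: XM.
  - by move=> z Iz; exists X0 => //; apply: IX0.
  - by move=> k [X FX Xk]; have [_ _ nX] := good _ _ FX Xk; apply: nX Xk.
have [P [QP maxP]] := Zorn_bigcup QU.
have QI : Q I by right; split.
have I0 : I 0 by case: idI.
have [P0|[idP IP nP]] := QP.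
  exfalso; apply: (maxP I) => //; rewrite P0; split=> //.
  by move/(_ 0 I0).
exists P; split=> // g nPg.
have [P0 PD PM] := idP.
pose P' : set A := [set x | exists a, P (x - a * g)].
have idP' : is_ideal P'.
  split.
  - by exists 0; rewrite mul0r subr0.
  - move=> x y [a Pa] [b Pb]; exists (a + b).
    by have := PD _ _ Pa Pb; rewrite mulrDl opprD addrACA.
  - move=> x y [a Pa]; exists (x * a).
    by have := PM x _ Pa; rewrite mulrBr mulrA.
have PP' : P `<=` P' by move=> x Px; exists 0; rewrite mul0r subr0.
apply: contrapT => nk; apply: (maxP P').
  split=> // /(_ g) H; apply: nPg; apply: H; exists 1; by rewrite mul1r subrr.
right; split=> //; first by move=> x /IP /PP'.
by move=> k [a Pa]; apply: nk; exists k, a.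
Qed.

(** Polynomials of size at most [b] only involve the monomials of degree less than [b], whose number
    bounds the dimension of their span. *)
Lemma small_span_relation (K : fieldType) (m b N : nat) (g : 'I_N -> {mpoly K[m]}) :
  (forall j, msize (g j) <= b)%N -> (#|{: 'X_{1..m < b}}| < N)%N ->
  exists c : 'I_N -> K, (exists j, c j != 0) /\ \sum_j c j *: g j = 0.
Proof.
move=> sz ltN.
pose G : 'M[K]_(N, #|{: 'X_{1..m < b}}|) :=
  \matrix_(j, l) (g j)@_(bmnm (enum_val l : 'X_{1..m < b})).
have /rowV0Pn [v /sub_kermxP vG v0] : kermx G != 0.
  by rewrite kermx_eq0 -row_leq_rank -ltnNge; apply: leq_ltn_trans ltN; apply: rank_leq_col.
exists (fun j => v 0 j); split.
  apply: contrapT => /forallNP n0; case/eqP: v0; apply/rowP=> j; rewrite mxE.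
  by have /negP := n0 j; rewrite negbK => /eqP.
apply/mpolyP => mm; rewrite mcoeff0 raddf_sum /=.
rewrite (eq_bigr (fun j => v 0 j * (g j)@_mm)); last by move=> j _; rewrite mcoeffZ.
have [ltb|leb] := ltnP (mdeg mm) b; last first.
  rewrite big1 // => j _; rewrite (_ : (g j)@_mm = 0) ?mulr0 //.
  apply/eqP; rewrite mcoeff_eq0; apply/negP => /msize_mdeg_lt.
  by rewrite ltnNge (leq_trans (sz j)).
have := congr1 (fun u : 'rV_ _ => u 0 (enum_rank (BMultinom ltb))) vG.
by rewrite !mxE => e; rewrite -[RHS]e; apply: eq_bigr => j _; rewrite !mxE enum_rankK.
Qed.

Variable K : closedFieldType.
Hypothesis K_large : large_fibre K.
Variable m : nat.
Local Notation ring := {mpoly K[m]}.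
Implicit Types (f g : ring).

(* Otherwise f^k - g_a (x - a) is in [P] for every [a], and one degree bound serves
   infinitely many [a].  A linear relation between the g_a then turns into a nonzero
   polynomial in [x] in the prime ideal [P], one of whose linear factors is in [P]. *)
Lemma variable_value (P : set ring) f (x : ring) : is_ideal P ->
  (forall k, ~ P (f ^+ k)) -> (forall g, ~ P g -> exists k a, P (f ^+ k - a * g)) ->
  exists a : K, P (x - a%:A).
Proof.
move=> [P0 PD PM] nP maxP.
(* An ideal maximal among those avoiding the powers of [f] is prime. *)
have Pprime g h : P (g * h) -> P g \/ P h.
  move=> Pgh; apply: contrapT => /not_orP [/maxP [k [a Pa]] /maxP [l [b Pb]]].
  apply: (nP (k + l)%N); rewrite exprD.
  have -> : f ^+ k * f ^+ l = f ^+ l * (f ^+ k - a * g) + (a * g *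
    (f ^+ l - b * h) + a * b * (g * h)).
    by ring.
  by apply: (PD); [|apply: (PD)]; apply: (PM).
apply: contrapT => /forallNP nx.
have /choice [kg kgP] : forall a, exists kg : nat * ring, P (f ^+ kg.1 - kg.2 * (x - a%:A)).
  move=> a; have [k [g Pg]] := maxP _ (nx a); by exists (k, g).
(* The exponent and the size are packed into one natural number, so that infinitely many values [a]
   share both. *)
have [d dP] := K_large (fun a => pickle ((kg a).1, msize (kg a).2)).
have [[k b] kbP] : exists kb, forall a, pickle ((kg a).1, msize (kg a).2) = d ->
   ((kg a).1, msize (kg a).2) = kb.
  have [s [_ szs sP]] := dP 1%N; case: s szs sP => [//|a0 s _ sP].
  exists ((kg a0).1, msize (kg a0).2) => a da.
  apply: (pcan_inj (@pickleK _)); rewrite da -(sP a0) ?mem_head //.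
pose N := (#|{: 'X_{1..m < b}}|).+1.
have [s [us szs sP]] := dP N.
pose r (j : 'I_N) := s`_j.
have rs j : r j \in s by rewrite mem_nth ?szs.
have r_inj : injective r.
  by move=> i j /eqP; rewrite /r nth_uniq ?szs // => /eqP /val_inj.
have rP j : P (f ^+ k - (kg (r j)).2 * (x - (r j)%:A)).
  by have [<- _] := kbP _ (sP _ (rs j)); apply: kgP.
have [|c [[j0 cj0] crel]] := @small_span_relation K m b N (fun j => (kg (r j)).2) _ (ltnSn _).
  by move=> j; have [_ ->] := kbP _ (sP _ (rs j)).
(* Multiplying f^k - g_j (x - r_j) by the other factors x - r_l and summing with coefficients c_j
   shows that f^k u(x) is, modulo [P], the product of all factors times the sum of the c_j g_j,
   which vanishes. *)
pose u : {poly K} := \sum_j c j *: \prod_(l | l != j) ('X - (r l)%:P).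
have u0 : u != 0.
  apply/eqP => u0; have : u.[r j0] = 0 by rewrite u0 horner0.
  rewrite /u horner_sum (bigD1 j0) //= [X in _ + X]big1 => [|j jj0]; last first.
    by rewrite hornerZ (bigD1 j0) 1?eq_sym //= hornerM hornerXsubC subrr mul0r mulr0.
  rewrite addr0 hornerZ horner_prod => /eqP; rewrite mulf_eq0 (negPf cj0) /=.
  apply/negP; apply/prodf_neq0 => l lj; rewrite hornerXsubC subr_eq0.
  by apply: contra lj => /eqP /r_inj ->.
have Pu : P (f ^+ k * horner_alg x u).
  rewrite /u linear_sum mulr_sumr /=.
  have -> : \sum_j f ^+ k * horner_alg x (c j *: \prod_(l | l != j) ('X - (r l)%:P)) =
    \sum_j (c j *: \prod_(l | l != j) (x - (r l)%:A)) * (f ^+ k - (kg (r j)).2 * (x -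
      (r j)%:A)) +
    (\sum_j c j *: (kg (r j)).2) * \prod_l (x - (r l)%:A).
    rewrite mulr_suml -big_split /=; apply: eq_bigr => j _.
    rewrite linearZ /= rmorph_prod /=.
    under eq_bigr do rewrite rmorphB /= horner_algX horner_algC.
    rewrite [X in _ = _ + _ * X](bigD1 j) //= -!scalerAl -!scalerAr -scalerDr.
    by congr (_ *: _); ring.
  rewrite crel mul0r addr0; apply: ideal_sum => // j _; by apply: (PM).
case: (Pprime _ _ Pu) => [/nP //|{}Pu].
move: Pu.
have [rt ->] := closed_field_poly_normal u.
rewrite linearZ /= rmorph_prod /= => Pu.
have {Pu} : P (\prod_(z <- rt) (x - z%:A)).
  have -> : \prod_(z <- rt) (x - z%:A) = ((lead_coef u)^-1)%:A *
      ((lead_coef u)%:A * \prod_(z <- rt) horner_alg x ('X - z%:P)).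
    rewrite -!scalerAl !mul1r scalerA mulVf ?lead_coef_eq0 // scale1r.
    by apply: eq_bigr => z _; rewrite rmorphB /= horner_algX horner_algC.
  exact: (PM).
elim: rt => [|z rt IH]; first by rewrite big_nil; apply: (nP 0%N).
by rewrite big_cons => Pu; case: (Pprime _ _ Pu) => [/nx|].
Qed.

(** If no power of [f] is in [I], let [P] be maximal above [I] avoiding these powers. Modulo [P]
    each variable, hence each polynomial, is congruent to a constant, its value at a point [v].
    There [I] vanishes, while [f] does not because it is not in [P]. *)
Theorem strong_nullstellensatz (I : set ring) f : is_ideal I ->
  (forall v, (forall g, I g -> g.@[v] = 0) -> f.@[v] = 0) -> radical I f.
Proof.
move=> idI vf; apply: contrapT => /forallNP nI.
have [P [idP IP nP maxP]] := maximal_ideal_avoiding_powers idI nI.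
have [P0 PD PM] := idP.
have [v vP] := choice (fun i : 'I_m => variable_value 'X_i idP nP maxP).
have PC c : P c%:A -> c = 0.
  move=> Pc; apply/eqP; apply: contraT => c0; case: (nP 0%N).
  by have := PM (c^-1)%:A _ Pc; rewrite -scalerAl mul1r scalerA mulVf // scale1r.
have PV : forall g, P (g - (g.@[v])%:A).
  have PVM g h : P (g - (g.@[v])%:A) -> P (h - (h.@[v])%:A) -> P (g * h - ((g * h).@[v])%:A).
    move=> Pg Ph; rewrite mevalM.
    have -> : g * h - (g.@[v] * h.@[v])%:A = h * (g - (g.@[v])%:A) + (g.@[v])%:A * (h -
      (h.@[v])%:A).
      by rewrite -scalerA -[X in _ *: X]mul1r scalerAl; ring.
    by apply: (PD); apply: (PM).
  have PV1 : P (1 - (1.@[v])%:A) by rewrite meval1 scale1r subrr.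
  elim/mpolyind=> [|c mm g _ _ IH]; first by rewrite meval0 scale0r subrr.
  rewrite mevalD mevalZ scalerDl opprD addrACA; apply: (PD) => //.
  have -> : c *: 'X_[mm] - (c * 'X_[mm].@[v])%:A = c%:A * ('X_[mm] - ('X_[mm].@[v])%:A) :> ring.
    by rewrite -scalerAl mul1r scalerBr scalerA.
  apply: (PM); rewrite mpolyXE_id.
  elim/big_rec: _ => // i h _ Ph; apply: (PVM) => //.
  elim: (mm i) => [|e IHe]; first by rewrite expr0.
  by rewrite exprS; apply: (PVM) => //; rewrite mevalXU.
apply: (nP 1%N); rewrite expr1.
have := PV f; rewrite vf ?scale0r ?subr0 // => g /IP Pg.
apply: PC; have -> : (g.@[v])%:A = g + (-1) * (g - (g.@[v])%:A) by ring.
by apply: (PD) => //; apply: (PM).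
Qed.

End Nullstellensatz.

(** * Vector configurations and realizations *)

Section Configurations.
Variables (K : fieldType) (n : nat) (E : finType).
Implicit Types (gamma : 'M[K]_(n, #|E|)) (S : {set E}) (l : 'rV[K]_n).

Definition pairing gamma l (x : E) : K := (l *m gamma) 0 (enum_rank x).

Definition dependent gamma S : Prop := exists a : E -> K,
  (exists2 x, x \in S & a x != 0) /\
  forall i, \sum_(x in S) a x * gamma i (enum_rank x) = 0.

Lemma pairingE gamma l x : pairing gamma l x = \sum_i l 0 i * gamma i (enum_rank x).
Proof. by rewrite /pairing mxE. Qed.

Lemma pairing_sum gamma l S (a : E -> K) :
  (forall i, \sum_(x in S) a x * gamma i (enum_rank x) = 0) ->
  \sum_(x in S) a x * pairing gamma l x = 0.
Proof.
move=> ha; under eq_bigr do rewrite pairingE mulr_sumr.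
rewrite exchange_big big1 //= => i _.
under eq_bigr do rewrite mulrCA.
by rewrite -mulr_sumr ha mulr0.
Qed.

Lemma dependentS gamma S S' : S \subset S' -> dependent gamma S -> dependent gamma S'.
Proof.
move=> sS [a [[x xS ax] ha]]; exists (fun y => if y \in S then a y else 0); split.
  by exists x; [exact: fintype.subsetP sS x xS | rewrite xS].
move=> i; rewrite -[RHS](ha i) [RHS]big_mkcond [LHS]big_mkcond; apply: eq_bigr => y _ /=.
by case: (boolP (y \in S)) => [/(fintype.subsetP sS) ->|_]; rewrite ?mul0r ?if_same.
Qed.

(** A vector outside the span of the vectors of [S] is not killed by some column of the cokernel
    matrix, and this column is the separating form. *)
Lemma separation gamma S x :
  (exists l, (forall y, y \in S -> pairing gamma l y = 0) /\ pairing gamma l x != 0) \/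
  (exists a : E -> K, forall i, gamma i (enum_rank x) = \sum_(y in S) a y * gamma i
    (enum_rank y)).
Proof.
(* The rows of the points outside [S] are zero, so that the row space is the span of the vectors of
   [S]. *)
pose G : 'M[K]_(#|E|, n) := \matrix_(j, i) if enum_val j \in S then gamma i j else 0.
pose u : 'rV[K]_n := \row_i gamma i (enum_rank x).
have [/submxP [v uE]|nu] := boolP (u <= G)%MS.
  right; exists (fun y => v 0 (enum_rank y)) => i.
  have := congr1 (fun w : 'rV_n => w 0 i) uE; rewrite !mxE => ->.
  rewrite [RHS]big_mkcond (reindex (@enum_rank E)) /=; last exact/onW_bij/enum_rank_bij.
  by apply: eq_bigr => y _; rewrite mxE enum_rankK; case: ifP; rewrite ?mulr0.
left; have /cV0Pn [r ur] : (u *m cokermx G)^T != 0.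
  by rewrite -(inj_eq trmx_inj) trmxK trmx0 -submxE.
exists (\row_i cokermx G i r); split.
  move=> y yS; have := congr1 (fun w : 'M_(_, _) => w (enum_rank y) r) (mulmx_coker G).
  rewrite mxE [in RHS]mxE => e0; rewrite -[RHS]e0 pairingE; apply: eq_bigr => i _.
  by rewrite !mxE enum_rankK yS mulrC.
move: ur; apply: contraNneq => e0; apply/eqP; rewrite -[RHS]e0 pairingE mxE mxE.
by apply: eq_bigr => i _; rewrite !mxE mulrC.
Qed.

Lemma dependent_family gamma (k : nat) (e : 'I_k -> E) : injective e ->
  dependent gamma [set e j | j in 'I_k] <->
  exists v : 'I_k -> K, (exists j, v j != 0) /\
    forall i, \sum_j v j * gamma i (enum_rank (e j)) = 0.
Proof.
move=> inj_e; split=> [[a [[_ /imsetP [j _ ->] aj] ha]]|[v [[j vj] hv]]].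
  exists (a \o e); split; first by exists j.
  by move=> i; rewrite -[RHS](ha i) big_imset //= => ? ? _ _ /inj_e.
exists (fun x => \sum_(j | e j == x) v j).
have vE j' : \sum_(j | e j == e j') v j = v j'.
  by rewrite (big_pred1 j') // => i; rewrite (inj_eq inj_e).
split; first by exists (e j); rewrite ?imset_f // vE.
move=> i; rewrite -[RHS](hv i) big_imset /=; last by move=> ? ? _ _ /inj_e.
by apply: eq_bigr => j' _; rewrite vE.
Qed.

Lemma dependent_free gamma (s : seq E) : uniq s ->
  ~~ free [seq col (enum_rank x) gamma | x <- s] <-> dependent gamma [set x in s].
Proof.
move=> us.
have e_inj : injective (tnth (in_tuple s)) by apply/tuple_uniqP.
have -> : [set x in s] = [set tnth (in_tuple s) j | j in 'I_(size s)].
  apply/setP=> x; rewrite inE; apply/idP/imsetP => [xs|[j _ ->]]; last exact: mem_tnth.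
  have /tnthP [j ->] : x \in in_tuple s by [].
  by exists j.
rewrite dependent_family //.
pose X := [tuple col (enum_rank (tnth (in_tuple s) j)) gamma | j < size s].
have -> : [seq col (enum_rank x) gamma | x <- s] = X.
  rewrite /X /= -[in LHS](in_tupleE s) -{1}(map_tnth_enum (in_tuple s)) -map_comp.
  by [].
have XE (v : 'I_(size s) -> K) i : (\sum_j v j *: X`_j) i 0 =
    \sum_j v j * gamma i (enum_rank (tnth (in_tuple s) j)).
  by rewrite summxE; apply: eq_bigr => j _; rewrite mxE -tnth_nth tnth_mktuple mxE.
split.
  move=> /freeP nf; apply: contrapT => nv; apply: nf => v v0 j.
  apply/eqP/negPn/negP => vj; apply: nv; exists v; split; first by exists j.
  by move=> i; rewrite -XE v0 mxE.
move=> [v [[j vj] hv]]; apply/negP => /freeP /(_ v) fX; case/eqP: vj; apply: fX.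
by apply/colP=> i; rewrite XE hv mxE.
Qed.

Lemma dependent_det gamma (e : 'I_n -> E) : injective e ->
  \det (\matrix_(i, j) gamma i (enum_rank (e j))) = 0 <-> dependent gamma [set e j | j in 'I_n].
Proof.
move=> inj_e; rewrite dependent_family // -det_tr; split.
  move=> /eqP /det0P [v /rV0Pn [j vj] v0]; exists (fun j => v 0 j); split; first by exists j.
  move=> i; have := congr1 (fun w : 'rV_n => w 0 i) v0; rewrite !mxE => e0; rewrite -[RHS]e0.
  by apply: eq_bigr => j' _; rewrite !mxE.
move=> [v [[j vj] hv]]; apply/eqP/det0P; exists (\row_j v j).
  by apply/rV0Pn; exists j; rewrite mxE.
apply/rowP=> i; rewrite !mxE -[RHS](hv i).
by apply: eq_bigr => j' _; rewrite !mxE.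
Qed.

Lemma dependent_card gamma S : (n < #|S|)%N -> dependent gamma S.
Proof.
move=> ltn; have -> : S = [set (enum_val j : E) | j in 'I_#|S|].
  apply/setP=> x; apply/idP/imsetP => [xS|[j _ ->]]; last exact: enum_valP.
  by exists (enum_rank_in xS x); rewrite ?enum_rankK_in.
apply/dependent_family; first exact: enum_val_inj.
pose A : 'M[K]_(#|S|, n) := \matrix_(j, i) gamma i (enum_rank (enum_val j)).
have /rowV0Pn [v /sub_kermxP vA /rV0Pn [j vj]] : kermx A != 0.
  by rewrite kermx_eq0 -row_leq_rank -ltnNge; apply: leq_ltn_trans ltn; apply: rank_leq_col.
exists (fun j => v 0 j); split; first by exists j.
move=> i; have := congr1 (fun w : 'rV_n => w 0 i) vA; rewrite !mxE => e0; rewrite -[RHS]e0.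
by apply: eq_bigr => j' _; rewrite !mxE.
Qed.

Lemma dependent_pairing gamma l S : (0 < n)%N -> #|S| = n -> l != 0 ->
  (forall x, x \in S -> pairing gamma l x = 0) -> dependent gamma S.
Proof.
move=> n0 cS l0 hl; rewrite -cS in n0.
pose e (j : 'I_n) : E := enum_val (cast_ord (esym cS) j).
have inj_e : injective e by move=> i j /enum_val_inj /cast_ord_inj.
have -> : S = [set e j | j in 'I_n].
  apply/setP=> x; apply/idP/imsetP => [xS|[j _ ->]]; last exact: enum_valP.
  by exists (cast_ord cS (enum_rank_in xS x)); rewrite // /e cast_ordK enum_rankK_in.
apply/dependent_det => //; apply/eqP/det0P; exists l => //.
apply/rowP=> j; have := hl (e j) (enum_valP _); rewrite pairingE => e0.
by rewrite [RHS]mxE -[RHS]e0 mxE; apply: eq_bigr => i _; rewrite mxE.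
Qed.

End Configurations.

(** * Circuit rows evaluated at a configuration *)

Section Evaluation.
Variables (K : fieldType) (n : nat) (E : finType).
Local Notation ring := {mxpoly K[n, E]}.
Implicit Types (gamma : 'M[K]_(n, #|E|)) (f : ring) (q : 'cV[K]_n).

Lemma mx_evalE gamma : mx_eval gamma =1 meval (mxvec gamma 0).
Proof. by []. Qed.

Lemma mx_eval_generic gamma i j : mx_eval gamma (generic_mx K n E i j) = gamma i j.
Proof. by rewrite mx_evalE mxE mevalXU mxvecE. Qed.

Lemma mx_eval_det gamma k (A : 'M[ring]_k) :
  mx_eval gamma (\det A) = \det (\matrix_(i, j) mx_eval gamma (A i j)).
Proof.
rewrite mx_evalE -det_map_mx; congr (\det _).
by apply/matrixP=> i j; rewrite !mxE.
Qed.

Lemma mx_eval_circuit_row gamma (s : seq E) q x : uniq s -> size s = n -> x \in s ->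
  mx_eval gamma (circuit_row s q x) =
  (-1) ^+ n.-1 * det_cols [seq if y == x then q else col (enum_rank y) gamma | y <- s].
Proof.
move=> us sz xs; rewrite circuit_row_replace // mx_evalE rmorphM rmorphXn rmorphN1.
congr (_ * _); rewrite /det_cols -[LHS]/(mx_eval gamma _) mx_eval_det; congr (\det _);
  apply/matrixP=> i j.
rewrite !mxE !(nth_map x) ?sz //; case: eqP => _; rewrite !mxE.
  by rewrite mx_evalE mevalC.
by rewrite -mx_eval_generic mxE.
Qed.

(** As a linear form in [z], a circuit row is up to sign given by adj(A) q, where A is the matrix of
    the vectors of the circuit. *)
Lemma mx_eval_circuit_row_sum gamma (s : seq E) q (z : E -> K) x0 :
  uniq s -> size s = n ->
  \sum_x z x * mx_eval gamma (circuit_row s q x) =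
  (-1) ^+ n.-1 * ((\row_(j < n) z (nth x0 s j)) *m
     \adj (\matrix_(i, j) gamma i (enum_rank (nth x0 s j))) *m q) 0 0.
Proof.
move=> us sz; have := @det_cols_replace K n _ (fun x => col (enum_rank x) gamma) q s z us sz x0.
have -> : \matrix_(i < n, j < n) col (enum_rank (nth x0 s j)) gamma i 0 =
    \matrix_(i, j) gamma i (enum_rank (nth x0 s j)) by apply/matrixP=> i j; rewrite !mxE.
move=> <-; rewrite mulr_sumr (bigID (fun x => x \in s)) /= [X in _ + X]big1 ?addr0; last first.
  by move=> x xs; rewrite /circuit_row (negPf xs) mx_evalE meval0 mulr0.
rewrite -big_uniq //=; apply: eq_big_seq => x xs.
by rewrite mx_eval_circuit_row // mulrCA.
Qed.

(** If z is l A with det(A) = 0, then z adj(A) = det(A) l = 0. *)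
Lemma mx_eval_circuit_row_pairing gamma (s : seq E) q (l : 'rV_n) (z : E -> K) :
  (0 < n)%N -> uniq s -> size s = n -> dependent gamma [set x in s] ->
  (forall x, x \in s -> z x = pairing gamma l x) ->
  \sum_x z x * mx_eval gamma (circuit_row s q x) = 0.
Proof.
move=> n0 us sz dep hz.
have [x0 _] : exists x0, x0 \in s by case: (s) sz n0 => [<-//|x t _ _]; exists x;
  rewrite mem_head.
rewrite (mx_eval_circuit_row_sum _ _ _ x0) //.
set A := (\matrix_(i, j) gamma i (enum_rank (nth x0 s j))).
have inj_s : injective (fun j : 'I_n => nth x0 s j).
  by move=> i j /eqP; rewrite nth_uniq ?sz // => /eqP/val_inj.
have detA : \det A = 0.
  apply/(dependent_det _ inj_s); apply: dependentS dep; apply/fintype.subsetP=> x.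
  rewrite inE => xs; apply/imsetP; have ltx : (index x s < n)%N by rewrite -sz index_mem.
  by exists (Ordinal ltx); rewrite //= nth_index.
have -> : \row_(j < n) z (nth x0 s j) = l *m A.
  apply/rowP=> j; rewrite mxE hz ?mem_nth ?sz // pairingE mxE.
  by apply: eq_bigr => i _; rewrite mxE.
by rewrite -[l *m A *m _]mulmxA mul_mx_adj detA mul_mx_scalar scale0r mul0mx mxE mulr0.
Qed.

Lemma adj_col n' (A : 'M[K]_n') (q : 'cV[K]_n') s :
  (\adj A *m q) s 0 = \det (\matrix_(i, j) if j == s then q i 0 else A i j).
Proof.
rewrite mxE (expand_det_col _ s); apply: eq_bigr => i _.
rewrite !mxE eqxx mulrC; congr (_ * _); rewrite /cofactor; congr (_ * \det _).
apply/matrixP=> a b; rewrite !mxE.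
by rewrite eq_sym (negPf (neq_lift s b)).
Qed.

(* The vector [adj(A) q] spans the kernel of [A]. *)
Lemma adj_kernel n' (A : 'M[K]_n') (q : 'cV[K]_n') (h z : 'rV[K]_n') :
  h != 0 -> h *m A = 0 -> (h *m q) 0 0 != 0 ->
  (forall l : 'rV_n', l *m A = 0 -> exists c, l = c *: h) ->
  (z *m \adj A *m q) 0 0 = 0 -> exists l : 'rV_n', z = l *m A.
Proof.
move=> h0 hA hq annA zq.
have detA : \det A = 0 by apply/eqP/det0P; exists h.
have [/submxP //|] := boolP (z <= A)%MS.
rewrite submxE => /matrix0Pn [i [r zr]]; rewrite ord1 {i} in zr.
pose w := col r (cokermx A).
have Aw : A *m w = 0 by rewrite /w colE mulmxA mulmx_coker mul0mx.
have zw : (z *m w) 0 0 != 0 by move: zr; rewrite /w colE mulmxA -colE [in X in _ -> X]mxE.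
have w0 : w != 0 by apply: contraNneq zw => ->; rewrite mulmx0 mxE.
have [s ws] : exists s, w s 0 != 0 by have /cV0Pn := w0.
(* The replaced column is one at which [w] is nonzero, so that [A *m w = 0] recovers it from the
   others. Hence a left kernel vector of [D] is a multiple of [h] that kills [q], that is, zero. *)
pose D := \matrix_(i, j) if j == s then q i 0 else A i j.
have detD : \det D != 0.
  apply/det0P => -[l /negP l0 lD]; apply: l0.
  have lq : (l *m q) 0 0 = 0.
    have := congr1 (fun v : 'rV_n' => v 0 s) lD; rewrite !mxE => e0; rewrite -[RHS]e0.
    by apply: eq_bigr => i _; rewrite mxE eqxx.
  have lj j : j != s -> (l *m A) 0 j = 0.
    move=> js; have := congr1 (fun v : 'rV_n' => v 0 j) lD; rewrite !mxE => e0;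
      rewrite -[RHS]e0.
    by apply: eq_bigr => i _; rewrite mxE (negPf js).
  have ls : (l *m A) 0 s = 0.
    have : (l *m A *m w) 0 0 = 0 by rewrite -mulmxA Aw mulmx0 mxE.
    rewrite mxE (bigD1 s) //= big1 ?addr0 => [/eqP|j js]; last by rewrite lj // mul0r.
    by rewrite mulf_eq0 (negPf ws) orbF => /eqP.
  have /annA [c lE] : l *m A = 0.
    by apply/rowP=> j; rewrite [RHS]mxE; have [->|/lj] := eqVneq j s.
  move: lq; rewrite lE -scalemxAl mxE => /eqP; rewrite mulf_eq0 (negPf hq) orbF.
  by move=> /eqP ->; rewrite scale0r.
pose u := \adj A *m q.
have us : u s 0 = \det D by rewrite adj_col.
have Au : A *m u = 0 by rewrite /u mulmxA mul_mx_adj detA mul_scalar_mx scale0r.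
pose c := w s 0 / u s 0.
(* The entry of [w'] at [s] is zero, so [D] kills [w'] as [A] does. Thus [w] is a multiple of adj(A)
   q, on which [z] vanishes. *)
pose w' := w - c *: u.
have w's : w' s 0 = 0 by rewrite /w' mxE [X in _ + X]mxE [X in _ - X]mxE /c divfK ?subrr // us.
have Aw' : A *m w' = 0 by rewrite mulmxBr Aw -scalemxAr Au scaler0 subr0.
have Dw' : D *m w' = 0.
  rewrite -Aw'; apply/colP=> i; rewrite [LHS]mxE [RHS]mxE; apply: eq_bigr => j _.
  rewrite [D i j]mxE; case: eqP => // ->; by rewrite w's !mulr0.
have unitD : D \in unitmx by rewrite unitmxE unitfE.
have w'0 : w' = 0 by rewrite -[w'](mulKmx unitD) Dw' mulmx0.
have wE : w = c *: u by apply/eqP; rewrite -subr_eq0 -/w' w'0.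
by case/eqP: zw; rewrite wE -scalemxAr mxE /u mulmxA zq mulr0.
Qed.

(** A converse of [mx_eval_circuit_row_pairing], when the vectors of the circuit span a hyperplane,
    of normal [h], that does not contain [q]. *)
Lemma circuit_row_functional gamma (s : seq E) q (h : 'rV[K]_n) (z : E -> K) :
  (0 < n)%N -> uniq s -> size s = n -> h != 0 -> (h *m q) 0 0 != 0 ->
  (forall x, x \in s -> pairing gamma h x = 0) ->
  (forall l, (forall x, x \in s -> pairing gamma l x = 0) -> exists c, l = c *: h) ->
  \sum_x z x * mx_eval gamma (circuit_row s q x) = 0 ->
  exists l, forall x, x \in s -> z x = pairing gamma l x.
Proof.
move=> n0 us sz h0 hq hs ann.
have [x0 _] : exists x0, x0 \in s by case: (s) sz n0 => [<-//|x t _ _]; exists x;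
  rewrite mem_head.
rewrite (mx_eval_circuit_row_sum _ _ _ x0) // => /eqP.
rewrite mulf_eq0 signr_eq0 /=; set A := (\matrix_(i,
  j) gamma i (enum_rank (nth x0 s j))) => /eqP zA.
have pA l j : (l *m A) 0 j = pairing gamma l (nth x0 s j).
  by rewrite pairingE mxE; apply: eq_bigr => i _; rewrite mxE.
have [|l lA|l zl] := adj_kernel h0 _ hq _ zA.
- by apply/rowP=> j; rewrite pA mxE hs // mem_nth ?sz.
- apply: ann => x xs; have ltx : (index x s < n)%N by rewrite -sz index_mem.
  by rewrite -(nth_index x0 xs) -(pA l (Ordinal ltx)) lA mxE.
exists l => x xs; have ltx : (index x s < n)%N by rewrite -sz index_mem.
have := congr1 (fun v : 'rV_n => v 0 (Ordinal ltx)) zl.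
by rewrite pA mxE /= nth_index.
Qed.

End Evaluation.

(** * Realizations and the vanishing of circuit minors and graph polynomials *)

Section Realizations.
Variables (K : fieldType) (n : nat) (E : finType) (M : matroid E).
Implicit Types (gamma : 'M[K]_(n, #|E|)) (S : {set E}).

Lemma realizationP gamma : realization_space M gamma <->
  forall S, dependent gamma S <-> ~~ indep M S.
Proof.
have dE S : ~~ free [seq col (enum_rank p) gamma | p <- enum S] <-> dependent gamma S.
  rewrite dependent_free ?enum_uniq //.
  by have -> : [set x in enum S] = S by apply/setP=> x; rewrite inE mem_enum.
by split=> H S; have := H S; rewrite ?dE // -dE.
Qed.

(** The zero set of [f] is Zariski closed, so it contains the closure as soon as it contains the
    realizations. *)
Lemma matroid_idealP f : matroid_ideal K n M f <->
  forall gamma, realization_space M gamma -> mx_eval gamma f = 0.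
Proof.
split=> [If gamma rg|Zf gamma]; first by apply: If => W [_]; apply.
move=> /(_ (fun g => mx_eval g f = 0)); apply; split; last by move=> g rg /=; apply: Zf.
by exists (fun g => g = f); apply/seteqP; split=> g /=; [move=> ge _ -> | apply].
Qed.

Lemma circuit_minor_vanish gamma f :
  realization_space M gamma -> circuit_minor K n M f -> mx_eval gamma f = 0.
Proof.
move=> /realizationP rg [r [a [b [_ inc_b /circuitP [dC _] ->]]]].
have inj_e : injective (fun j : 'I_r => enum_val (b j) : E).
  by move=> i j /enum_val_inj /(increasing_inj inc_b).
have /rg /(dependent_family _ inj_e) [v [[j vj] hv]] := dC.
rewrite mx_eval_det -det_tr; apply/eqP/det0P; exists (\row_j v j).
  by apply/rV0Pn; exists j; rewrite mxE.
apply/rowP=> i; rewrite !mxE -[RHS](hv (a i)); apply: eq_bigr => j' _.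
by rewrite !mxE mx_evalE mevalXU mxvecE enum_valK.
Qed.

Lemma circuit_minors_dependent gamma C :
  (forall f, circuit_minor K n M f -> mx_eval gamma f = 0) ->
  circuit M C -> #|C| = n -> dependent gamma C.
Proof.
move=> cv cC szC.
pose B : {set 'I_#|E|} := [set enum_rank x | x in C].
have szB : #|B| = n by rewrite card_imset //; apply: enum_rank_inj.
pose b (j : 'I_n) : 'I_#|E| := enum_val (cast_ord (esym szB) j).
have inj_b : injective b by move=> i j /enum_val_inj /cast_ord_inj.
(* [enum] lists the ordinals of [B] in increasing order, as [circuit_minor] wants. *)
have inc_b : increasing b.
  move=> i j ltij; rewrite /b !(enum_val_nth (enum_default (cast_ord (esym szB) i))) /=.
  set x0 := enum_default _.
  have sB : sorted ltn (map val (enum B)).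
    rewrite /enum_mem; apply: (subseq_sorted ltn_trans (map_subseq val (filter_subseq _ _))).
    by rewrite -enumT val_enum_ord iota_ltn_sorted.
  have szB' : size (enum B) = n by rewrite -cardE.
  have := sorted_ltn_nth ltn_trans 0%N sB i j; rewrite !inE !size_map szB' !ltn_ord.
  by move=> /(_ isT isT ltij); rewrite !(nth_map x0) ?szB'.
have inj_e : injective (fun j : 'I_n => enum_val (b j) : E).
  by move=> i j /enum_val_inj /inj_b.
have CE : C = [set enum_val (b j) | j in 'I_n].
  apply/eqP; rewrite eq_sym eqEcard card_imset // card_ord szC leqnn andbT.
  apply/fintype.subsetP=> _ /imsetP [j _ ->].
  have /imsetP [x xC ->] : b j \in B by apply: enum_valP.
  by rewrite enum_rankK.
rewrite CE; apply/(dependent_det _ inj_e).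
rewrite -[RHS](cv (\det (mxsub id b (generic_mx K n E)))); last first.
  by exists n, id, b; split=> //; rewrite -CE.
rewrite mx_eval_det; congr (\det _); apply/matrixP=> i j.
by rewrite !mxE mx_evalE mevalXU mxvecE enum_valK.
Qed.

Lemma indep_extend S : indep M S -> exists B : {set E}, [/\ S \subset B,
  indep M B & #|B| = rank M setT].
Proof.
have [B0 [_ iB0 szB0]] := rank_indep M setT.
move: {2}(#|B0| - #|S|)%N (erefl (#|B0| - #|S|)%N) => m.
elim: m S => [|m IH] S em iS.
  exists S; split=> //; apply/eqP; rewrite eqn_leq indep_leq_rank ?subsetT //=.
  by rewrite -szB0 -subn_eq0 em.
have [x /setDP [xB xS] ix] : exists2 x, x \in B0 :\: S & indep M (x |: S).
  by apply: indep_aug => //; rewrite -subn_gt0 em.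
have [|//|B [sB iB cB]] := IH (x |: S).
  by rewrite cardsU1 xS add1n subnS em.
by exists B; split=> //; apply: subset_trans sB; apply: subsetUr.
Qed.

(** An independent set of [M] with dependent vectors would extend to a basis with dependent vectors,
    and the vectors of a circuit of size n + 1 are dependent for dimension reasons. *)
Lemma realization_criterion gamma : paving M n ->
  (forall B, indep M B -> #|B| = n -> ~ dependent gamma B) ->
  (forall C, circuit M C -> #|C| = n -> dependent gamma C) ->
  realization_space M gamma.
Proof.
move=> [rM pM] hB hC; apply/realizationP => S; split.
  move=> dS; apply/negP => /indep_extend [B [sB iB cB]].
  by apply: (hB B) => //; [rewrite cB | apply: dependentS dS].
move=> /dependent_circuit [C cC sC]; apply: dependentS sC _.
have [szC|szC] := pM C cC; first exact: hC.
by apply: dependent_card; rewrite szC.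
Qed.

(** For a basis [B] of [J], the set [x |: B] is independent, hence some form kills [B] but not [x].
    It also kills the other points of [J], which depend on [B]. *)
Lemma realization_closure gamma J x : realization_space M gamma ->
  x \notin matroid_closure M J ->
  exists l, (forall y, y \in J -> pairing gamma l y = 0) /\ pairing gamma l x != 0.
Proof.
move=> /realizationP rg xJ; have [B [sB iB cB]] := rank_indep M J.
have dJ y : y \in J -> y \notin B -> ~~ indep M (y |: B).
  move=> yJ yB; apply/negP => iy.
  have : (#|y |: B| <= rank M J)%N.
    by apply: indep_leq_rank => //; apply/subUsetP; split; rewrite ?sub1set.
  by rewrite cardsU1 yB -cB ltnn.
have xB : x \notin B.
  by apply: contra xJ => xB; apply: (fintype.subsetP (subset_closure M J));
    apply: fintype.subsetP sB _ xB.
have ixB : indep M (x |: B).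
  have ltr : (rank M J < rank M (x |: J))%N.
    rewrite ltn_neqAle rankS ?subsetUr // andbT eq_sym.
    by move: xJ; rewrite inE.
  have [C [sC iC cC]] := rank_indep M (x |: J).
  have [y /setDP [yC yB] iy] := indep_aug iB iC (leq_trans (eq_leq (congr1 S cB))
    (leq_trans ltr (eq_leq (esym cC)))).
  have := fintype.subsetP sC y yC; rewrite in_setU1 => /orP [/eqP <- //|yJ].
  by move: (dJ y yJ yB); rewrite iy.
have [[l [lB lx]]|[a ax]] := separation gamma B x; last first.
  have /rg : dependent gamma (x |: B); last by rewrite ixB.
  exists (fun y => if y == x then -1 else a y); split.
    by exists x; rewrite ?setU11 // eqxx oppr_eq0 oner_eq0.
  move=> i; rewrite big_setU1 //= eqxx mulN1r (ax i) addrC.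
  apply/eqP; rewrite subr_eq0; apply/eqP/eq_bigr => y yB.
  by case: eqP => // yx; rewrite -yx yB in xB.
exists l; split=> // y yJ; have [yB|yB] := boolP (y \in B); first exact: lB.
have /rg [b [[w wB bw] hb]] := dJ y yJ yB.
have := pairing_sum l hb; rewrite big_setU1 //= [X in _ + X]big1 ?addr0; last first.
  by move=> v vB; rewrite lB // mulr0.
move=> /eqP; rewrite mulf_eq0 => /orP [/eqP by0|/eqP //].
have /rg : dependent gamma B; last by rewrite iB.
exists b; split.
  exists w => //; move: wB; rewrite in_setU1 => /orP [/eqP wy|//].
  by rewrite wy by0 eqxx in bw.
by move=> i; rewrite -[RHS](hb i) big_setU1 //= by0 mul0r add0r.
Qed.

(* For a functional [l] killing [J], the vector [l(gamma_p)] is in the kernel of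
   the matrix whose determinant is the graph polynomial. *)
Lemma graph_poly_vanish gamma f :
  realization_space M gamma -> graph_poly K n M f -> mx_eval gamma f = 0.
Proof.
move=> rg [J [k [p [c [q [[k0 inj_p dPJ cP] _ ->]]]]]].
have hc i : ohead (c i) = Some (p i) by have [_ []] := cP i.
rewrite graph_polynomial_det // mx_eval_det -det_tr.
pose i0 : 'I_k := Ordinal k0.
have n0 : (0 < n)%N.
  by have [[_ _ <-] [hd _ _]] := cP i0; case: (c i0) hd.
have pJ : p i0 \notin matroid_closure M J.
  by apply/negP => pi; move/pred0P/(_ (p i0)): dPJ; rewrite /= pi imset_f.
have [l [lJ lp]] := realization_closure rg pJ.
apply/eqP/det0P; exists (\row_j pairing gamma l (p j)).
  by apply/rV0Pn; exists i0; rewrite mxE.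
apply/rowP=> i; rewrite !mxE.
have [[/circuitP [dC _] us sz] [_ sPJ _]] := cP i.
have dep : dependent gamma [set x in c i] by move/realizationP: rg => ->.
rewrite -[RHS](mx_eval_circuit_row_pairing (q i) (z := pairing gamma l) n0 us sz dep
  (fun x _ => erefl)).
rewrite (bigID (fun x => x \in [set p j | j in 'I_k])) /= [X in _ = _ + X]big1 ?addr0;
  last first.
  move=> x xP; have [xc|xc] := boolP (x \in c i); last first.
    by rewrite /circuit_row (negPf xc) mx_evalE meval0 mulr0.
  have := fintype.subsetP sPJ x; rewrite inE => /(_ xc);
    rewrite in_setU (negPf xP) /= => /lJ ->.
  by rewrite mul0r.
rewrite big_imset /=; last by move=> ? ? _ _ /inj_p.
by apply: eq_bigr => j _; rewrite !mxE.
Qed.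

End Realizations.

(** * Dependent hyperplanes of a paving matroid *)

Lemma subset_of_card (T : finType) (A : {set T}) k : (k <= #|A|)%N ->
  exists2 B : {set T}, B \subset A & #|B| = k.
Proof.
move=> lek; exists [set x in take k (enum A)].
  by apply/fintype.subsetP=> x; rewrite inE => /mem_take; rewrite mem_enum.
have ut : uniq (take k (enum A)) by apply: take_uniq; apply: enum_uniq.
rewrite cardsE; move/card_uniqP: ut => ->.
by rewrite size_take -cardE; case: ltngtP lek.
Qed.

Lemma set_family (T : finType) (A : {set T}) k : #|A| = k ->
  exists2 e : 'I_k -> T, injective e & A = [set e j | j in 'I_k].
Proof.
move=> <-; exists enum_val; first exact: enum_val_inj.
apply/setP=> x; apply/idP/imsetP => [xA|[j _ ->]]; last exact: enum_valP.
by exists (enum_rank_in xA x); rewrite ?enum_rankK_in.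
Qed.

Section Paving.
Variables (E : finType) (M : matroid E) (n : nat).
Hypothesis Mpaving : paving M n.
Implicit Types (A B C H : {set E}).

Lemma paving_indep A : (#|A| < n)%N -> indep M A.
Proof.
move=> ltA; apply: contraT => /dependent_circuit [C cC sC].
have leC := subset_leq_card sC.
by have [szC|szC] := Mpaving.2 C cC; rewrite szC in leC; lia.
Qed.

Lemma paving_circuit A : #|A| = n -> ~~ indep M A -> circuit M A.
Proof.
move=> szA dA; apply/circuitP; split=> // B pB.
by apply: paving_indep; rewrite -szA; apply: proper_card.
Qed.

Lemma dep_hyperplaneP H : dep_hyperplane M n H ->
  [/\ (n <= #|H|)%N, forall C, C \subset H -> #|C| = n -> circuit M C &
    forall B, H \subset B -> (forall C, C \subset B -> #|C| = n -> circuit M C) -> B = H].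
Proof.
move=> /maxsetP [/andP [leH /forallP cH] mH]; split=> //.
  by move=> C sC szC; apply: (implyP (cH C)); rewrite sC szC eqxx.
move=> B sHB cB; apply: mH => //; rewrite (leq_trans leH (subset_leq_card sHB)) /=.
by apply/forallP=> C; apply/implyP=> /andP [sC /eqP]; apply: cB.
Qed.

Lemma circuit_dep_hyperplane C : circuit M C -> #|C| = n ->
  exists2 H, dep_hyperplane M n H & C \subset H.
Proof.
move=> cC szC; have [|H mH sH] := @maxset_exists _ (fun H => (n <= #|H|)%N &&
    [forall C : {set E}, (C \subset H) && (#|C| == n) ==> circuit M C]) C.
  rewrite szC leqnn /=; apply/forallP=> D; apply/implyP=> /andP [sD /eqP szD].
  by have /eqP -> : D == C by rewrite eqEcard sD szC szD leqnn.
by exists H.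
Qed.

Lemma dep_hyperplane_gt0 H : dep_hyperplane M n H -> (0 < n)%N.
Proof.
move=> /dep_hyperplaneP [_ cH _]; rewrite lt0n; apply/eqP=> n0.
have := cH set0 (sub0set _); rewrite cards0 n0 => /(_ erefl) /circuitP [].
by rewrite indep_set0.
Qed.

(** If both contained a set [A] of n - 1 points, an independent n-subset of the union would augment
    [A], inside one of the two, to an independent set of n points. So the n-subsets of the union are
    circuits, and by maximality both hyperplanes equal the union. *)
Lemma dep_hyperplaneI H1 H2 : dep_hyperplane M n H1 -> dep_hyperplane M n H2 -> H1 != H2 ->
  (#|H1 :&: H2|.+1 < n)%N.
Proof.
move=> dH1 dH2; apply: contraR; rewrite -leqNgt => leI.
have n0 := dep_hyperplane_gt0 dH1.
have [le1 c1 m1] := dep_hyperplaneP dH1; have [le2 c2 m2] := dep_hyperplaneP dH2.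
have [|A sA szA] := @subset_of_card _ (H1 :&: H2) n.-1; first by lia.
have ltA : (#|A| < n)%N by rewrite szA prednK.
move: sA; rewrite subsetI => /andP [sA1 sA2].
have cU C : C \subset H1 :|: H2 -> #|C| = n -> circuit M C.
  move=> sC szC; apply: paving_circuit => //; apply/negP => iC.
  have [|x /setDP [xC xA] ix] := indep_aug (paving_indep ltA) iC; first by rewrite szC.
  have szxA : #|x |: A| = n by rewrite cardsU1 xA szA add1n prednK.
  have : circuit M (x |: A).
    have := fintype.subsetP sC x xC; rewrite inE => /orP [] xH.
      by apply: c1 => //; apply/subUsetP; rewrite sub1set.
    by apply: c2 => //; apply/subUsetP; rewrite sub1set.
  by move=> /circuitP [/negP].
by rewrite -(m1 _ (subsetUl _ _) cU) {1}(m2 _ (subsetUr _ _) cU).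
Qed.

(** The rank of [H] is less than n, so adjoining a point of its closure keeps all n-subsets
    dependent, against maximality unless the point is in [H]. *)
Lemma dep_hyperplane_closure H : dep_hyperplane M n H -> matroid_closure M H \subset H.
Proof.
move=> dH; have n0 := dep_hyperplane_gt0 dH; have [leH cH mH] := dep_hyperplaneP dH.
apply/fintype.subsetP=> x; rewrite inE => /eqP eqr.
have rH : (rank M H < n)%N.
  rewrite ltnNge; apply/negP; have [B [sB iB <-]] := rank_indep M H.
  move=> /subset_of_card [C sC szC].
  have /circuitP [/negP dC _] := cH C (subset_trans sC sB) szC.
  by apply: dC; apply: indep_sub iB.
have <- : x |: H = H; last exact: setU11.
apply: mH; first exact: subsetUr.
move=> C sC szC; apply: paving_circuit => //; apply/negP=> iC.
by have := indep_leq_rank sC iC; rewrite eqr szC leqNgt rH.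
Qed.

End Paving.

(** * Polynomial curves and generic parameters *)

Section GenericParameters.
Variable K : numFieldType.

(** The exceptions are among the zeros of a single polynomial, a form stable under finite
    conjunctions. *)
Definition generic (P : K -> Prop) : Prop :=
  exists g : {poly K}, g != 0 /\ forall t, g.[t] != 0 -> P t.

Lemma poly_zeros (p : {poly K}) : (forall t, p.[t] = 0) -> p = 0.
Proof.
move=> p0; apply/eqP; apply: contraT => pn0.
have := @max_poly_roots _ p [seq i%:R | i <- iota 0 (size p)] pn0.
rewrite size_map size_iota ltnn; apply.
  by apply/allP=> x _; apply/rootP.
by rewrite map_inj_uniq ?iota_uniq //; apply: (mulrIn (@oner_neq0 K)).
Qed.

Lemma genericS (P Q : K -> Prop) : (forall t, P t -> Q t) -> generic P -> generic Q.
Proof. by move=> PQ [g [g0 gP]]; exists g; split=> // t /gP /PQ. Qed.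

Lemma generic_all (P : K -> Prop) : (forall t, P t) -> generic P.
Proof. by move=> allP; exists 1; split=> //; apply: oner_neq0. Qed.

Lemma generic_and (P Q : K -> Prop) : generic P -> generic Q -> generic (fun t => P t /\ Q t).
Proof.
move=> [g [g0 gP]] [h [h0 hQ]]; exists (g * h); split; first by rewrite mulf_neq0.
by move=> t; rewrite hornerM mulf_eq0 negb_or => /andP [/gP ? /hQ ?].
Qed.

Lemma generic_forall (T : finType) (P : T -> K -> Prop) :
  (forall x, generic (P x)) -> generic (fun t => forall x, P x t).
Proof.
move=> /fin_all_exists [g gP]; exists (\prod_x g x); split.
  by apply/prodf_neq0 => x _; have [] := gP x.
move=> t; rewrite horner_prod => /prodf_neq0 gt x.
by have [_] := gP x; apply; apply: gt.
Qed.

Lemma generic_imp (Q : Prop) (P : K -> Prop) : (Q -> generic P) -> generic (fun t => Q -> P t).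
Proof.
move=> QP; have [q|nq] := pselect Q; last by apply: generic_all.
by apply: genericS (QP q).
Qed.

Lemma generic_neq (p : {poly K}) t0 : p.[t0] != 0 -> generic (fun t => p.[t] != 0).
Proof. by move=> pt; exists p; split=> //; apply: contraNneq pt => ->; rewrite horner0. Qed.

Definition mx_at m k (t : K) (A : 'M[{poly K}]_(m, k)) : 'M[K]_(m,
  k) := map_mx (horner_eval t) A.

Lemma mx_atM m k r t (A : 'M[{poly K}]_(m, k)) (B : 'M_(k, r)) :
  mx_at t (A *m B) = mx_at t A *m mx_at t B.
Proof. exact: map_mxM. Qed.

Lemma mx_at_const m k t (A : 'M[K]_(m, k)) : mx_at t (map_mx polyC A) = A.
Proof. by apply/matrixP=> i j; rewrite !mxE /= horner_evalE hornerC. Qed.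

Lemma det_mx_at k t (A : 'M[{poly K}]_k) : \det (mx_at t A) = (\det A).[t].
Proof. by rewrite det_map_mx. Qed.

(** If [a] is a right inverse at [t0], then det(T a) takes the value 1 at [t0], and [T] is row free
    wherever this polynomial is nonzero. *)
Lemma generic_row_free m k (T : 'M[{poly K}]_(m, k)) t0 :
  row_free (mx_at t0 T) -> generic (fun t => row_free (mx_at t T)).
Proof.
move=> /row_freeP [a Ta]; apply: (@genericS (fun t => (\det (T *m map_mx polyC a)).[t] != 0)).
  move=> t; rewrite -det_mx_at mx_atM mx_at_const -unitfE -unitmxE => u.
  by apply/row_freeP; exists (a *m invmx (mx_at t T *m a)); rewrite mulmxA mulmxV.
apply: (@generic_neq _ t0); rewrite -det_mx_at mx_atM mx_at_const Ta det1; exact: oner_neq0.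
Qed.

(* Oblique projection of [u] on the kernel of [T] along the columns of [a]. *)
Lemma kernel_projection m k (T : 'M[{poly K}]_(m, k)) (a : 'M_(k, m)) (u : 'cV_k) :
  exists v : 'cV[{poly K}]_k, T *m v = 0 /\
    forall t, mx_at t T *m mx_at t a = 1%:M -> mx_at t T *m mx_at t u = 0 ->
      mx_at t v = mx_at t u.
Proof.
exists (\det (T *m a) *: u - a *m (\adj (T *m a) *m (T *m u))); split.
  rewrite mulmxBr -scalemxAr !mulmxA mul_mx_adj mul_scalar_mx -scalemxAl subrr //.
move=> t Ta Tu; rewrite /mx_at raddfB /= -!/(mx_at t _) !mx_atM Tu !mulmx0 subr0.
have -> : mx_at t (\det (T *m a) *: u) = \det (mx_at t (T *m a)) *: mx_at t u.
  by rewrite det_mx_at; apply/matrixP=> i j; rewrite !mxE /= !horner_evalE hornerM.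
by rewrite mx_atM Ta det1 scale1r.
Qed.

(** Used to follow a point along moving hyperplanes whose normals are independent at time 0. *)
Lemma kernel_transport m k (T : 'M[{poly K}]_(m, k)) (u : 'cV[K]_k) :
  row_free (mx_at 0 T) -> mx_at 0 T *m u = 0 ->
  exists v : 'cV[{poly K}]_k, T *m v = 0 /\ mx_at 0 v = u.
Proof.
move=> /row_freeP [a Ta] Tu.
have [v [Tv vu]] := kernel_projection T (map_mx polyC a) (map_mx polyC u).
by exists v; split=> //; rewrite vu !mx_at_const.
Qed.

Lemma row_free_pair m k (T : 'M[K]_(m, k)) : (m <= 2)%N ->
  (forall i, row i T != 0) ->
  (forall i j, i != j -> forall c, row j T != c *: row i T) -> row_free T.
Proof.
move=> le2 T0 Tp; apply/inj_row_free => v vT; apply/rowP=> i; rewrite mxE.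
apply/eqP; apply: contraT => vi.
have eT : \sum_j v 0 j *: row j T = 0 by rewrite -mulmx_sum_row.
have [/existsP [j /andP [ji vj]]|/existsPn vj] := boolP [exists j, (j != i) && (v 0 j != 0)].
  have only l : l != i -> l != j -> False.
    move=> li lj; have u3 : uniq [:: i; j; l].
      by rewrite /= !inE negb_or eq_sym ji eq_sym li eq_sym lj.
    by have := max_card (mem [:: i; j; l]); rewrite (card_uniqP u3) card_ord /=; lia.
  case/negP: (Tp i j (contra_neq esym ji) (- (v 0 i / v 0 j))).
  move: eT; rewrite (bigD1 i) //= (bigD1 j) //= big1 ?addr0 => [|l /andP [li lj]];
    last by case: (only l).
  move=> /eqP; rewrite addrC addr_eq0 => /eqP e.
  by rewrite -(scalerK vj (row j T)) e scalerN scalerA mulrC scaleNr.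
case/negP: (T0 i); move: eT; rewrite (bigD1 i) //= big1 ?addr0 => [/eqP|j ji].
  by rewrite scaler_eq0 (negPf vi).
by have := vj j; rewrite ji negbK => /eqP ->; rewrite scale0r.
Qed.

End GenericParameters.

(** * Deforming transverse configurations *)

Section Deformations.
Variables (K : numFieldType) (n : nat) (E : finType) (M : matroid E).
Hypothesis Mpaving : paving M n.
Hypothesis Mdegree : forall p : E, (degree M n p <= 2)%N.
Implicit Types (gamma : 'M[K]_(n, #|E|)) (G : 'M[{poly K}]_(n, #|E|)) (B H : {set E}).
Local Notation hyperplane := (dep_hyperplane M n).

(** Membership in the Zariski closure of the realization space, tested on polynomials. *)
Definition closure_point gamma : Prop := forall f : {mxpoly K[n, E]},
  (forall gamma', realization_space M gamma' -> mx_eval gamma' f = 0) -> mx_eval gamma f = 0.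

Lemma mx_eval_curve G (f : {mxpoly K[n, E]}) :
  exists p : {poly K}, forall t, mx_eval (mx_at t G) f = p.[t].
Proof.
exists (\sum_(m <- msupp f) (f@_m)%:P * \prod_i mxvec G 0 i ^+ m i) => t.
rewrite mx_evalE mevalE horner_sum; apply: eq_bigr => m _.
rewrite hornerM hornerC horner_prod; congr (_ * _); apply: eq_bigr => i _.
by rewrite horner_exp; congr (_ ^+ _); case/mxvec_indexP: i => i j; rewrite !mxvecE mxE.
Qed.

(** Restricted to the curve, a polynomial vanishing on the realizations is a polynomial in t that
    vanishes for generic t, hence is zero. *)
Lemma closure_point_curve G :
  generic (fun t => closure_point (mx_at t G)) -> closure_point (mx_at 0 G).
Proof.
move=> [g [g0 gP]] f hf; have [p pE] := mx_eval_curve G f.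
rewrite pE; suff -> : p = 0 by rewrite horner0.
apply/eqP; rewrite -[_ == 0]orFb -(negPf g0) -mulf_eq0; apply/eqP/poly_zeros => t.
rewrite hornerM; have [->|/gP cl] := eqVneq g.[t] 0; first by rewrite mul0r.
by rewrite -pE cl // mulr0.
Qed.

Lemma generic_independent G B t0 : #|B| = n -> ~ dependent (mx_at t0 G) B ->
  generic (fun t => ~ dependent (mx_at t G) B).
Proof.
move=> /set_family [e inj_e ->].
pose D : 'M[{poly K}]_n := \matrix_(i, j) G i (enum_rank (e j)).
have dE t : dependent (mx_at t G) [set e j | j in 'I_n] <-> (\det D).[t] = 0.
  rewrite -dependent_det // -det_mx_at.
  have -> : \matrix_(i, j) mx_at t G i (enum_rank (e j)) = mx_at t D.
    by apply/matrixP=> i j; rewrite !mxE.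
  by [].
move=> nd; apply: (@genericS _ (fun t => (\det D).[t] != 0)).
  by move=> t /negP nt /dE d0; apply: nt; apply/eqP.
by apply: (@generic_neq _ _ t0); apply/eqP => /dE.
Qed.

Definition through (x : E) : {set {set E}} := [set H : {set E} | hyperplane H & x \in H].

(** Over any ring, so as to serve both for constant normals and for polynomial curves of normals. *)
Definition normals (A : nzRingType) (h : {set E} ->
  'rV[A]_n) (x : E) : 'M[A]_(#|through x|, n) :=
  \matrix_(i, j) h (enum_val i) 0 j.

Definition incident gamma (h : {set E} -> 'rV[K]_n) : Prop :=
  forall H, hyperplane H -> forall x, x \in H -> pairing gamma (h H) x = 0.

Definition transverse (h : {set E} -> 'rV[K]_n) : Prop := forall x, row_free (normals h x).

Lemma normals_row (A : nzRingType) (h : {set E} ->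
  'rV[A]_n) x i : row i (normals h x) = h (enum_val i).
Proof. by apply/rowP=> j; rewrite !mxE. Qed.

Lemma normals_incident (A : nzRingType) (h : {set E} -> 'rV[A]_n) x (v : 'cV_n) :
  normals h x *m v = 0 <-> forall H, hyperplane H -> x \in H -> (h H *m v) 0 0 = 0.
Proof.
split=> [hv H dH xH|hv].
  have Hx : H \in through x by rewrite inE dH.
  have := congr1 (fun w : 'cV_ _ => w (enum_rank_in Hx H) 0) hv.
  rewrite !mxE => e; rewrite -[RHS]e; apply: eq_bigr => j _.
  by rewrite mxE enum_rankK_in.
apply/colP=> i; have := enum_valP i; rewrite inE => /andP [dH xH].
rewrite [RHS]mxE -[RHS](hv _ dH xH) !mxE; apply: eq_bigr => j _.
by rewrite mxE.
Qed.

Lemma incidentP gamma h : incident gamma h <->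
  forall x, normals h x *m col (enum_rank x) gamma = 0.
Proof.
have pE H x : (h H *m col (enum_rank x) gamma) 0 0 = pairing gamma (h H) x.
  by rewrite pairingE mxE; apply: eq_bigr => j _; rewrite mxE.
split=> [ih x|ih H dH x xH].
  by apply/normals_incident => H dH xH; rewrite pE ih.
by have /normals_incident /(_ H dH xH) := ih x; rewrite pE.
Qed.

(** By the degree bound there are at most two rows, so pairwise independence suffices. *)
Lemma normals_row_free (h : {set E} -> 'rV[K]_n) x :
  (forall H, hyperplane H -> x \in H -> h H != 0) ->
  (forall H H', hyperplane H -> hyperplane H' -> H != H' -> x \in H -> x \in H' ->
    forall c, h H' != c *: h H) -> row_free (normals h x).
Proof.
move=> h0 hp; apply: row_free_pair.
- by have := Mdegree x; rewrite /degree -/(through x).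
- by move=> i; rewrite normals_row; have := enum_valP i; rewrite inE => /andP [dH xH];
  apply: h0.
- move=> i j ij c; rewrite !normals_row.
  have := enum_valP i; have := enum_valP j; rewrite !inE => /andP [dj xj] /andP [di xi].
  by apply: hp => //; apply: contra ij => /eqP /enum_val_inj ->.
Qed.

(* Realize the basis [B] as the canonical basis: then a hyperplane [H] must be the
   zero set of a linear form in the coordinates outside [H]. *)
Lemma basis_witness B : indep M B -> #|B| = n ->
  exists (h : {set E} -> 'rV[K]_n) gamma,
    [/\ forall x, x \in B -> row_free (normals h x),
        forall x, x \in B -> normals h x *m col (enum_rank x) gamma = 0 &
        ~ dependent gamma B].
Proof.
move=> iB szB; have [e inj_e BE] := set_family szB.
pose first H j := (e j \notin H) && [forall j', (e j' \notin H) ==> (j <= j')%N].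
(* Distinct nonzero constants: hyperplanes containing the same points of [B] still get
   nonproportional forms, with coefficient [c H] at the first basis point outside and 1 at the next
   ones. *)
pose c H : K := (enum_rank H).+1%:R.
pose h H : 'rV[K]_n := \row_j if e j \in H then 0 else if first H j then c H else 1.
pose gamma : 'M[K]_(n, #|E|) := \matrix_(i, p) (e i == enum_val p)%:R.
have c0 H : c H != 0 by rewrite pnatr_eq0.
have c_inj : injective c.
  by move=> H H' /(mulrIn (@oner_neq0 K)) [] /val_inj /enum_rank_inj.
have hj0 H j : (h H 0 j == 0) = (e j \in H).
  rewrite mxE; case: ifP => _; first by rewrite eqxx.
  by case: ifP => _; rewrite ?(negPf (c0 H)) ?oner_eq0.
have outside H : hyperplane H -> exists j, e j \notin H.
  move=> dH; apply: contrapT => /forallNP nj.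
  have [_ cH _] := dep_hyperplaneP dH.
  have sBH : B \subset H.
    rewrite BE; apply/fintype.subsetP=> _ /imsetP [j _ ->].
    by have /negP := nj j; rewrite negbK.
  by have /circuitP [/negP] := cH B sBH szB.
have first_ex H : hyperplane H -> exists j, first H j.
  move=> /outside [j0 j0H]; case: (@arg_minnP _ j0 (fun j => e j \notin H) (fun j =>
    j : nat) j0H) => j jH jmin.
  by exists j; rewrite /first jH; apply/forallP=> j'; apply/implyP; apply: jmin.
exists h, gamma; split.
- move=> x xB; apply: normals_row_free.
    move=> H /outside [j jH] _; apply: contraNneq jH => h0.
    by rewrite -hj0 h0 mxE.
  move=> H H' dH dH' HH' _ _ r; apply/negP => /eqP hr.
  have r0 : r != 0.
    have [j jH'] := outside H' dH'; apply: contraNneq jH' => r0.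
    by rewrite -hj0 hr r0 scale0r mxE.
  have same j : (e j \in H') = (e j \in H).
    by rewrite -!hj0 hr mxE mulf_eq0 (negPf r0).
  have same_first j : first H' j = first H j.
    by rewrite /first same; congr (_ && _); apply: eq_forallb => j'; rewrite same.
  have [j0 fj0] := first_ex H dH.
  have /andP [j0H _] := fj0.
  (* Two dependent hyperplanes share at most n - 2 points, so at least two points of [B] are
     outside. *)
  have [j1 j1H j10] : exists2 j1, e j1 \notin H & j1 != j0.
    apply: contrapT => nj.
    have sB : B :\ e j0 \subset H :&: H'.
      apply/fintype.subsetP=> y; rewrite in_setD1 => /andP [yj0].
      rewrite BE => /imsetP [j _ yj]; rewrite inE yj same andbb.
      apply: contraT => jH; case: nj; exists j => //.
      by apply: contraNneq yj0 => <-; rewrite yj.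
    have := subset_leq_card sB; have := dep_hyperplaneI Mpaving dH dH' HH'.
    have e0B : e j0 \in B by rewrite BE imset_f.
    by have := cardsD1 (e j0) B; rewrite szB e0B; lia.
  have nf1 : ~~ first H j1.
    apply: contra j10 => /andP [_ /forallP /(_ j0)]; rewrite j0H /= => le10.
    have /andP [_ /forallP /(_ j1)] := fj0; rewrite j1H /= => le01.
    by apply/eqP/val_inj/eqP; rewrite eqn_leq le10 le01.
  have := congr1 (fun v : 'rV_n => v 0 j1) hr.
  rewrite !mxE same same_first (negPf j1H) (negPf nf1) mulr1 => r1.
  have := congr1 (fun v : 'rV_n => v 0 j0) hr.
  rewrite !mxE same same_first (negPf j0H) fj0 -r1 mul1r => /c_inj H'H.
  by rewrite H'H eqxx in HH'.
- move=> x; rewrite {1}BE => /imsetP [j _ ->]; apply/normals_incident => H dH jH.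
  rewrite mxE (bigD1 j) //= big1 ?addr0 => [|i ij].
    by rewrite mxE jH mul0r.
  by rewrite [X in _ * X]mxE [X in _ * X]mxE enum_rankK (inj_eq inj_e) (negPf ij) mulr0.
- rewrite BE -dependent_det //.
  have -> : \matrix_(i, j) gamma i (enum_rank (e j)) = 1%:M.
    by apply/matrixP=> i j; rewrite !mxE enum_rankK (inj_eq inj_e).
  by rewrite det1; apply/eqP; apply: oner_neq0.
Qed.

Definition segment m k (A B : 'M[K]_(m, k)) : 'M[{poly K}]_(m, k) :=
  map_mx polyC A + 'X *: map_mx polyC (B - A).

Lemma mx_at_segment m k t (A B : 'M[K]_(m, k)) : mx_at t (segment A B) = A + t *: (B - A).
Proof. by apply/matrixP=> i j; rewrite !mxE /= horner_evalE !hornerE. Qed.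

Lemma segment0 m k (A B : 'M[K]_(m, k)) : mx_at 0 (segment A B) = A.
Proof. by rewrite mx_at_segment scale0r addr0. Qed.

Lemma segment1 m k (A B : 'M[K]_(m, k)) : mx_at 1 (segment A B) = B.
Proof. by rewrite mx_at_segment scale1r addrC subrK. Qed.

Lemma mx_at_normals t (h : {set E} -> 'rV[{poly K}]_n) x :
  mx_at t (normals h x) = normals (fun H => mx_at t (h H)) x.
Proof. by apply/matrixP=> i j; rewrite !mxE. Qed.

Lemma eq_dependent gamma gamma' B :
  (forall x, x \in B -> col (enum_rank x) gamma = col (enum_rank x) gamma') ->
  dependent gamma B -> dependent gamma' B.
Proof.
move=> eqg [a [ax ha]]; exists a; split=> // i; rewrite -[RHS](ha i).
apply: eq_bigr => x xB; have := congr1 (fun v : 'cV_n => v i 0) (eqg x xB).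
by rewrite !mxE => ->.
Qed.

(** The normals move along segments to those of the witness. Each point is an oblique projection on
    the kernel of its normals, along a segment of right inverses: it starts at its vector in [gamma]
    and, if in [B], passes at time 1 through its vector in the witness. *)
Lemma deform_towards_basis gamma h B : incident gamma h -> transverse h ->
  indep M B -> #|B| = n ->
  exists G (hp : {set E} -> 'rV[{poly K}]_n),
    [/\ mx_at 0 G = gamma, forall H, mx_at 0 (hp H) = h H,
        forall t, incident (mx_at t G) (fun H => mx_at t (hp H)) & ~ dependent (mx_at 1 G) B].
Proof.
move=> /incidentP ih th iB szB.
have [hB [gB [fB ihB dB]]] := basis_witness iB szB.
pose hp H := segment (h H) (hB H).
have n0 x : mx_at 0 (normals hp x) = normals h x.
  by rewrite mx_at_normals; apply/matrixP=> i j; rewrite [LHS]mxE [RHS]mxE segment0.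
have n1 x : mx_at 1 (normals hp x) = normals hB x.
  by rewrite mx_at_normals; apply/matrixP=> i j; rewrite [LHS]mxE [RHS]mxE segment1.
have /fin_all_exists [v vP] : forall x, exists v : 'cV[{poly K}]_n,
    [/\ normals hp x *m v = 0, mx_at 0 v = col (enum_rank x) gamma &
        x \in B -> mx_at 1 v = col (enum_rank x) gB].
  move=> x; have /row_freeP [a Ta] := th x.
  have [b Tb] : exists b, x \in B -> normals hB x *m b = 1%:M.
    have [xB|xB] := boolP (x \in B); last by exists 0.
    by have /row_freeP [b Tb] := fB x xB; exists b.
  have [v [Tv vu]] := kernel_projection (normals hp x) (segment a b)
    (segment (col (enum_rank x) gamma) (col (enum_rank x) gB)).
  exists v; split=> // [|xB]; rewrite vu ?segment0 ?segment1 ?n0 ?n1 //.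
  - exact: Tb.
  - exact: ihB.
pose G : 'M[{poly K}]_(n, #|E|) := \matrix_(i, p) v (enum_val p) i 0.
have colG t x : col (enum_rank x) (mx_at t G) = mx_at t (v x).
  by apply/colP=> i; rewrite !mxE enum_rankK.
exists G, hp; split.
- apply/matrixP=> i p; have := congr1 (fun w : 'cV_n => w i 0) (colG 0 (enum_val p)).
  by rewrite mxE enum_valK => ->; have [_ -> _] := vP (enum_val p); rewrite mxE enum_valK.
- by move=> H; rewrite segment0.
- move=> t; apply/incidentP => x; rewrite colG -mx_at_normals -mx_atM.
  by have [-> _ _] := vP x; apply/matrixP=> i j; rewrite !mxE /= horner_evalE horner0.
- move=> d1; apply: dB; apply: eq_dependent d1 => x xB.
  by rewrite colG; have [_ _ ->] := vP x.
Qed.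

(* Each basis that is dependent in [gamma] is made independent by moving generically
   along a line towards the witness of that basis. *)
Lemma transverse_closure_point gamma h :
  incident gamma h -> transverse h -> closure_point gamma.
Proof.
pose bad gamma := [set B : {set E} | indep M B && (#|B| == n) && `[< dependent gamma B >]].
move: {2}#|bad gamma|.+1 (ltnSn #|bad gamma|) => N.
elim: N gamma h => // N IH gamma h ltN ih th.
have [bad0|[B]] := set_0Vmem (bad gamma).
  (* Without bad bases [gamma] is a realization: an n-circuit lies in a dependent hyperplane, whose
     normal is nonzero by transversality. *)
  move=> f; apply; apply: realization_criterion => // [B iB szB dB|C cC szC].
    have : B \in bad gamma by rewrite inE iB szB eqxx; apply/asboolP.
    by rewrite bad0 inE.
  have [H dH sCH] := circuit_dep_hyperplane cC szC.
  have n0 := dep_hyperplane_gt0 dH.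
  have [x xC] : exists x, x \in C by apply/set0Pn; rewrite -card_gt0 szC.
  have xH := fintype.subsetP sCH x xC.
  apply: (@dependent_pairing _ _ _ _ (h H)) => //; last first.
    by move=> y yC; apply: ih => //; apply: fintype.subsetP sCH y yC.
  have Hx : H \in through x by rewrite inE dH.
  apply/negP => /eqP h0; have /row_freeP [a /matrixP /(_ (enum_rank_in Hx H)
    (enum_rank_in Hx H))] := th x.
  rewrite !mxE eqxx big1 => [/eqP|j _]; first by rewrite eq_sym oner_eq0.
  by rewrite mxE enum_rankK_in // h0 mxE mul0r.
rewrite inE => /andP [/andP [iB /eqP szB] /asboolP dB].
have [G [hp [G0 hp0 ihp dB1]]] := deform_towards_basis ih th iB szB.
rewrite -G0; apply: closure_point_curve.
have gT : generic (fun t => transverse (fun H => mx_at t (hp H))).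
  apply: generic_forall => x.
  apply: (@genericS _ (fun t => row_free (mx_at t (normals hp x)))).
    by move=> t; rewrite mx_at_normals.
  apply: (@generic_row_free _ _ _ _ 0).
  have -> : mx_at 0 (normals hp x) = normals h x; last exact: th.
  by rewrite mx_at_normals; apply/matrixP=> i j; rewrite [LHS]mxE [RHS]mxE hp0.
have gB := generic_independent szB dB1.
have gI : generic (fun t => forall B' : {set E}, #|B'| = n -> ~ dependent gamma B' ->
    ~ dependent (mx_at t G) B').
  apply: generic_forall => B'; apply: generic_imp => szB'; apply: generic_imp => nd.
  by apply: (@generic_independent _ _ 0); rewrite ?G0.
apply: genericS (generic_and gT (generic_and gB gI)) => t [tt [tB tI]].
apply: (IH _ (fun H => mx_at t (hp H))) => //.
rewrite -ltnS; apply: leq_ltn_trans ltN; apply: proper_card; apply/properP; split.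
  apply/fintype.subsetP=> B'; rewrite !inE => /andP [/andP [-> /eqP szB'] /asboolP d'].
  by rewrite szB' eqxx /=; apply/asboolP; apply: contrapT => /(tI B' szB').
exists B; rewrite inE iB szB eqxx /=; first exact/asboolP.
by apply/asboolP.
Qed.

End Deformations.

(** * Deforming flexible configurations *)

Section Degenerations.
Variables (K : numFieldType) (n : nat) (E : finType) (M : matroid E).
Hypothesis Mpaving : paving M n.
Implicit Types (gamma : 'M[K]_(n, #|E|)) (H : {set E}) (D : {set {set E}}) (h : 'rV[K]_n).
Local Notation hyperplane := (dep_hyperplane M n).

Lemma pairingD gamma h h' x : pairing gamma (h + h') x = pairing gamma h x + pairing gamma h' x.
Proof. by rewrite /pairing mulmxDl mxE. Qed.

Lemma pairingZ gamma c h x : pairing gamma (c *: h) x = c * pairing gamma h x.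
Proof. by rewrite /pairing -scalemxAl mxE. Qed.

Lemma pairingB gamma h h' x : pairing gamma (h - h') x = pairing gamma h x - pairing gamma h' x.
Proof. by rewrite pairingD -scaleN1r pairingZ mulN1r. Qed.

(* The first-order motions [h + t x_H] of the hyperplanes in [D], all equal to [h]
   at time 0, along which the common points of two of them can be followed. *)
Definition compatible gamma D (x : {set E} -> 'rV[K]_n) : Prop :=
  forall H H' y, H \in D -> H' \in D -> y \in H -> y \in H' ->
    pairing gamma (x H) y = pairing gamma (x H') y.

(** Equality is taken modulo [h] because adding a multiple of [h] to [x H] only rescales the normal
    to first order. *)
Definition rigid gamma h D : Prop := forall x, compatible gamma D x ->
  forall H H', H \in D -> H' \in D -> exists c, x H' - x H = c *: h.

(* The hyperplanes of normals [p] and [p'] intersect along a family of codimension 2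
   subspaces, whose limit at time 0 contains the vectors of [H] and [H']. *)
Definition separates gamma h H H' (p p' : 'rV[{poly K}]_n) : Prop :=
  exists l w, [/\ p' - p = 'X^l *: w, forall c, mx_at 0 w != c *: h &
    forall x, x \in H -> x \in H' -> pairing gamma (mx_at 0 w) x = 0].

Lemma mx_atB m k t (A B : 'M[{poly K}]_(m, k)) : mx_at t (A - B) = mx_at t A - mx_at t B.
Proof. exact: map_mxB. Qed.

Lemma mx_atZ m k t p (A : 'M[{poly K}]_(m, k)) : mx_at t (p *: A) = p.[t] *: mx_at t A.
Proof. by apply/matrixP=> i j; rewrite !mxE /= !horner_evalE hornerM. Qed.

Lemma mx_at_lift m k (A : 'M[K]_(m, k)) (B : 'M[{poly K}]_(m, k)) :
  mx_at 0 (map_mx polyC A + 'X *: B) = A.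
Proof. by apply/matrixP=> i j; rewrite !mxE /= horner_evalE !hornerE. Qed.

(* Not being rigid, [D] has a motion that splits it into smaller classes, inside which
   the same argument gives motions of higher order. *)
Lemma separating_motion gamma h D : h != 0 ->
  (forall H x, H \in D -> x \in H -> pairing gamma h x = 0) ->
  (forall D', D' \subset D -> (1 < #|D'|)%N -> ~ rigid gamma h D') ->
  exists y : {set E} -> 'rV[{poly K}]_n, forall H H', H \in D -> H' \in D -> H != H' ->
    separates gamma h H H' (y H) (y H').
Proof.
move=> h0; have [r hr] : exists r, h 0 r != 0 by have /rV0Pn := h0.
move: {2}#|D|.+1 (ltnSn #|D|) => N; elim: N D => // N IH D ltN hD flex.
have [le1|gt1] := leqP #|D| 1.
  exists (fun _ => 0) => H H' HD H'D HH'; case/negP: HH'.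
  by apply/eqP; move: le1 => /card_le1_eqP; apply.
have [x [cx [H0 [H1 [H0D H1D nx]]]]] : exists x, compatible gamma D x /\
    exists H H', [/\ H \in D, H' \in D & forall c, x H' - x H != c *: h].
  apply: contrapT => nx; apply: (flex D) => // x cx H H' HD H'D.
  apply: contrapT => nc; apply: nx; exists x; split=> //; exists H, H'; split=> // c.
  by apply/eqP => e; apply: nc; exists c.
(* The multiple of [h] that is subtracted makes the coordinate [r] vanish, so that motions congruent
   modulo [h] become equal. *)
pose z H := x H - (x H 0 r / h 0 r) *: h.
have zr H : z H 0 r = 0 by rewrite !mxE divfK // subrr.
have zP H H' c : z H' - z H = c *: h -> z H' = z H.
  move=> e; have : (z H' - z H) 0 r = (c *: h) 0 r by rewrite e.
  rewrite [RHS]mxE [LHS]mxE [X in _ + X]mxE !zr subrr => /esym /eqP.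
  rewrite mulf_eq0 (negPf hr) orbF => /eqP c0.
  by apply/eqP; rewrite -subr_eq0 e c0 scale0r.
have zpair H y : H \in D -> y \in H -> pairing gamma (z H) y = pairing gamma (x H) y.
  by move=> HD yH; rewrite pairingB pairingZ (hD H) // mulr0 subr0.
pose cl H := [set H' in D | z H' == z H].
have clS H : cl H \subset D by apply/fintype.subsetP=> H'; rewrite inE => /andP [].
(* If a class were all of [D], the motions [x] would all agree modulo [h], against their choice. *)
have cl_lt H : (#|cl H| < N)%N.
  rewrite -ltnS; apply: leq_ltn_trans ltN; apply: proper_card.
  rewrite properEneq clS andbT; apply/eqP => clD.
  have eqz H' : H' \in D -> z H' = z H by rewrite -clD inE => /andP [_ /eqP].
  case/negP: (nx (x H1 0 r / h 0 r - x H0 0 r / h 0 r)).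
  have := eqz _ H0D; rewrite -(eqz _ H1D) /z => e.
  by rewrite subr_eq scalerBl -addrA [- _ + _]addrC e addrC subrK.
have /choice [ys ysP] : forall C : {set {set E}}, exists y : {set E} -> 'rV[{poly K}]_n,
    C \subset D -> (#|C| < N)%N ->
    forall H H', H \in C -> H' \in C -> H != H' -> separates gamma h H H' (y H) (y H').
  move=> C; have [sC|] := boolP (C \subset D); last by exists (fun=> 0).
  have [ltC|] := boolP (#|C| < N)%N; last by exists (fun=> 0).
  have [||y yP] := IH C ltC.
  - by move=> H y HC; apply: hD; apply: fintype.subsetP sC H HC.
  - by move=> D' sD'; apply: flex; apply: subset_trans sC.
  - by exists y.
(* The first-order motion is corrected at higher order by the motion of the class of [H]. Inside a
   class the power of t increases by one; different classes are already separated by [z]. *)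
exists (fun H => map_mx polyC (z H) + 'X *: ys (cl H) H) => H H' HD H'D HH'.
have [zHH'|zHH'] := eqVneq (z H') (z H).
  have clE : cl H' = cl H by apply/setP=> H''; rewrite !inE zHH'.
  have [||l [w [e wh wp]]] := ysP (cl H) (clS H) (cl_lt H) H H' _ _ HH'.
  - by rewrite inE HD eqxx.
  - by rewrite inE H'D zHH' eqxx.
  exists l.+1, w; split=> //.
  by rewrite zHH' clE opprD addrACA subrr add0r -scalerBr e scalerA exprS.
exists 0%N, (map_mx polyC (z H') + 'X *: ys (cl H') H' - (map_mx polyC (z H) + 'X *: ys
  (cl H) H)).
split; first by rewrite expr0 scale1r.
  move=> c; rewrite mx_atB !mx_at_lift; apply: contra zHH' => /eqP /zP ->; exact: eqxx.
move=> y yH yH'; rewrite mx_atB !mx_at_lift pairingB !zpair //.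
by apply/eqP; rewrite subr_eq0; apply/eqP/cx.
Qed.

(** If the vectors of [S] had rank n, then n of them would be independent. *)
Lemma annihilator gamma (S : {set E}) :
  (forall C : {set E}, C \subset S -> #|C| = n -> dependent gamma C) ->
  exists l : 'rV[K]_n, l != 0 /\ forall x, x \in S -> pairing gamma l x = 0.
Proof.
move=> dS; pose A : 'M[K]_(#|S|, n) := \matrix_(i, j) gamma j (enum_rank (enum_val i)).
have ltr : (\rank A < n)%N.
  rewrite ltn_neqAle rank_leq_col andbT; apply/eqP => rA.
  pose e (j : 'I_n) : E := enum_val (maxrankfun A (cast_ord (esym rA) j)).
  have inj_e : injective e by move=> i j /enum_val_inj /maxrankfun_inj /cast_ord_inj.
  have /dS : [set e j | j in 'I_n] \subset S.
    by apply/fintype.subsetP=> _ /imsetP [j _ ->]; apply: enum_valP.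
  rewrite card_imset // card_ord => /(_ erefl) /(dependent_family _ inj_e) [v [[j vj] hv]].
  have /row_free_inj inj := maxrowsub_free A.
  have : (\row_j v (cast_ord rA j)) *m rowsub (maxrankfun A) A = 0 *m rowsub (maxrankfun A) A.
    rewrite mul0mx; apply/rowP=> i; rewrite [RHS]mxE -[RHS](hv i) mxE.
    rewrite (reindex (cast_ord rA)) /=; last first.
      by exists (cast_ord (esym rA)) => k _; rewrite ?cast_ordK ?cast_ordKV.
    by apply: eq_bigr => k _; rewrite !mxE /e cast_ordK.
  move=> /inj /rowP /(_ (cast_ord (esym rA) j)); rewrite !mxE cast_ordKV => vj0.
  by rewrite vj0 eqxx in vj.
have /rowV0Pn [l /sub_kermxP lA l0] : kermx A^T != 0.
  by rewrite kermx_eq0 -row_leq_rank -ltnNge mxrank_tr.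
exists l; split=> // x xS; have := congr1 (fun v : 'rV_ _ => v 0 (enum_rank_in xS x)) lA.
rewrite !mxE pairingE => e0; rewrite -[RHS]e0; apply: eq_bigr => i _.
by rewrite !mxE enum_rankK_in.
Qed.

(** The scaled coordinate depends only on which coordinates are nonzero, hence is the same for
    proportional vectors. *)
Definition normalize h : 'rV[K]_n :=
  if [pick r | h 0 r != 0] is Some r then (h 0 r)^-1 *: h else h.

Lemma normalizeE h : h != 0 -> exists2 c, c != 0 & normalize h = c *: h.
Proof.
move=> /rV0Pn [r hr]; rewrite /normalize; case: pickP => [r' hr'|/(_ r)]; last by rewrite hr.
by exists (h 0 r')^-1; rewrite // invr_eq0.
Qed.

(* Hence parallel normals become equal. *)
Lemma normalizeZ c h : c != 0 -> normalize (c *: h) = normalize h.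
Proof.
move=> c0; rewrite /normalize.
have -> : [pick r | (c *: h) 0 r != 0] = [pick r | h 0 r != 0].
  by apply: eq_pick => r /=; rewrite mxE mulf_eq0 (negPf c0).
case: pickP => [r hr|hN].
  by rewrite mxE scalerA invfM mulrAC mulVf // mul1r.
by apply/rowP=> r; have := hN r => /negbFE /eqP; rewrite mxE => ->; rewrite mulr0.
Qed.

Hypothesis Mdegree : forall p : E, (degree M n p <= 2)%N.

(** A point lies in at most two hyperplanes. If their normals satisfy p' - p = t^l w, both contain
    the kernel of p and w, which are independent at time 0, so [kernel_transport] follows the point.
    For generic t the normals are pairwise independent and [transverse_closure_point] applies. *)
Lemma separated_closure_point gamma (h : {set E} -> 'rV[K]_n) (hp : {set E} ->
  'rV[{poly K}]_n) :
  (forall H, hyperplane H -> h H != 0) -> incident M gamma h ->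
  (forall H, mx_at 0 (hp H) = h H) ->
  (forall H H', hyperplane H -> hyperplane H' -> H != H' ->
    separates gamma (h H) H H' (hp H) (hp H')) ->
  closure_point M gamma.
Proof.
move=> h0 ih hp0 sep.
have pair0 (T : 'rV[{poly K}]_n) x : mx_at 0 T *m col (enum_rank x) gamma = (pairing gamma
  (mx_at 0 T) x)%:M.
  apply/matrixP=> i j; rewrite !ord1 [RHS]mxE mulr1n pairingE mxE.
  by apply: eq_bigr => k _; rewrite [col _ _ _ _]mxE.
have free1 (v : 'rV[K]_n) : v != 0 -> row_free v by rewrite /row_free rank_rV => ->.
have free2 (v w : 'rV[K]_n) : v != 0 -> (forall c, w != c *: v) -> row_free (col_mx v w).
  move=> v0 wv; apply/inj_row_free => u.
  rewrite -[u]hsubmxK mul_row_col [lsubmx u]mx11_scalar [rsubmx u]mx11_scalar !mul_scalar_mx.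
  set a := lsubmx u 0 0; set b := rsubmx u 0 0 => e.
  have b0 : b = 0.
    apply/eqP; apply: contraT => b0; case/negP: (wv (- (a / b))).
    move: e => /eqP; rewrite addrC addr_eq0 => /eqP e.
    by rewrite -(scalerK b0 w) e scalerN scalerA mulrC scaleNr.
  move: e; rewrite b0 scale0r addr0 => /eqP; rewrite scaler_eq0 (negPf v0) orbF => /eqP ->.
  by rewrite -[0%:M]/(0%:M : 'M_1) raddf0 row_mx0.
have /fin_all_exists [v vP] : forall x, exists v : 'cV[{poly K}]_n,
    (forall H, hyperplane H -> x \in H -> hp H *m v = 0) /\ mx_at 0 v = col (enum_rank x) gamma.
  move=> x; have [th0|[H]] := set_0Vmem (through n M x).
    exists (map_mx polyC (col (enum_rank x) gamma)); rewrite mx_at_const; split=> // H dH xH.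
    by have : H \in through n M x; [rewrite inE dH | rewrite th0 inE].
  rewrite inE => /andP [dH xH].
  have [/existsP [H' /and3P [dH' xH' HH']]|/existsPn only] :=
      boolP [exists H' : {set E}, [&& hyperplane H', x \in H' & H' != H]]; last first.
    have [||v [Hv v0]] := @kernel_transport _ _ _ (hp H) (col (enum_rank x) gamma).
    - by rewrite hp0; apply/free1/h0.
    - by rewrite pair0 hp0 ih // raddf0.
    exists v; split=> // H' dH' xH'; have := only H'; rewrite dH' xH' /= negbK.
    by move=> /eqP ->.
  rewrite eq_sym in HH'; have [l [w [e wh wp]]] := sep H H' dH dH' HH'.
  have [||v [Tv v0]] := @kernel_transport _ _ _ (col_mx (hp H) w) (col (enum_rank x) gamma).
  - by rewrite /mx_at map_col_mx -!/(mx_at 0 _) hp0; apply: free2 => //; apply: h0.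
  - by rewrite /mx_at map_col_mx -!/(mx_at 0 _) mul_col_mx !pair0 hp0 ih // wp // raddf0
    col_mx0.
  move: Tv; rewrite mul_col_mx => /eqP; rewrite col_mx_eq0 => /andP [/eqP Hv /eqP wv].
  exists v; split=> // H'' dH'' xH''.
  have thE : through n M x = [set H; H'].
    apply/esym/eqP; rewrite eqEcard cards2 HH' Mdegree andbT.
    by apply/fintype.subsetP=> Z; rewrite !inE => /orP [] /eqP ->; rewrite ?dH ?dH'.
  have : H'' \in through n M x by rewrite inE dH''.
  rewrite thE !inE => /orP [] /eqP -> //.
  by rewrite -[hp H'](subrK (hp H)) e mulmxDl Hv addr0 -scalemxAl wv scaler0.
pose G : 'M[{poly K}]_(n, #|E|) := \matrix_(i, p) v (enum_val p) i 0.
have colG t x : col (enum_rank x) (mx_at t G) = mx_at t (v x).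
  by apply/colP=> i; rewrite !mxE enum_rankK.
have <- : mx_at 0 G = gamma.
  apply/matrixP=> i p; have := congr1 (fun w : 'cV_n => w i 0) (colG 0 (enum_val p)).
  by rewrite mxE enum_valK => ->; have [_ ->] := vP (enum_val p); rewrite mxE enum_valK.
apply: closure_point_curve.
have g1 : generic (fun t => forall H, hyperplane H -> row_free (mx_at t (hp H))).
  apply: generic_forall => H; apply: generic_imp => dH.
  by apply: (@generic_row_free _ _ _ _ 0); rewrite hp0; apply/free1/h0.
have g2 : generic (fun t => forall H H', hyperplane H -> hyperplane H' -> H != H' ->
    forall c, mx_at t (hp H') != c *: mx_at t (hp H)).
  apply: generic_forall => H; apply: generic_forall => H'.
  apply: generic_imp => dH; apply: generic_imp => dH'; apply: generic_imp => HH'.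
  have [l [w [e wh _]]] := sep H H' dH dH' HH'.
  have gX : generic (fun t : K => 'X.[t] != 0) by exists 'X; split=> //; rewrite polyX_eq0.
  have gw : generic (fun t => row_free (mx_at t (col_mx (hp H) w))).
    apply: (@generic_row_free _ _ _ _ 0).
    by rewrite /mx_at map_col_mx -!/(mx_at 0 _) hp0; apply: free2 => //; apply: h0.
  apply: genericS (generic_and gX gw) => t [Xt]; rewrite hornerX in Xt.
  rewrite /mx_at map_col_mx -!/(mx_at t _) => /row_free_inj inj c; apply/negP => /eqP hc.
  have : row_mx (1 - c)%:M (t ^+ l)%:M *m col_mx (mx_at t (hp H)) (mx_at t w) =
      0 *m col_mx (mx_at t (hp H)) (mx_at t w).
    rewrite mul0mx mul_row_col !mul_scalar_mx.
    have := congr1 (mx_at t) e; rewrite mx_atB mx_atZ hornerXn hc => <-.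
    by rewrite scalerBl scale1r addrC addrA subrK subrr.
  move=> /inj /eqP; rewrite row_mx_eq0 => /andP [_ /eqP /matrixP /(_ 0 0)].
  by rewrite !mxE mulr1n => /eqP; rewrite expf_eq0 (negPf Xt) andbF.
apply: genericS (generic_and g1 g2) => t [t1 t2].
apply: (@transverse_closure_point _ _ _ _ Mpaving Mdegree _ (fun H => mx_at t (hp H))).
  apply/incidentP => x; rewrite colG; apply/normals_incident => H dH xH.
  by rewrite -mx_atM; have [-> //] := vP x; rewrite !mxE /= horner_evalE horner0.
move=> x; apply: normals_row_free => // [H dH _|H H' dH dH' HH' _ _ c]; last exact: t2.
by apply: contraTneq (t1 H dH) => ->; rewrite /row_free mxrank0.
Qed.

(** The hyperplanes are grouped by normalized normal. Inside a group they move by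
    [separating_motion], multiplied by t; normals of different groups are already independent at
    time 0. *)
Lemma flexible_closure_point gamma :
  (forall C, circuit M C -> #|C| = n -> dependent gamma C) ->
  (forall h D, h != 0 -> (1 < #|D|)%N ->
    (forall H, H \in D -> hyperplane H /\ forall x, x \in H -> pairing gamma h x = 0) ->
    ~ rigid gamma h D) ->
  closure_point M gamma.
Proof.
move=> dC flex.
have /fin_all_exists [u uP] : forall H, exists l : 'rV[K]_n, hyperplane H ->
    l != 0 /\ forall x, x \in H -> pairing gamma l x = 0.
  move=> H; have [dH|] := boolP (hyperplane H); last by exists 0.
  have [_ cH _] := dep_hyperplaneP dH.
  have [|l lP] := @annihilator gamma H; last by exists l.
  by move=> C sC szC; apply: dC => //; apply: cH.
pose h H := normalize (u H).
have h0 H : hyperplane H -> h H != 0.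
  move=> /uP [u0 _]; have [c c0 e] := normalizeE u0.
  by rewrite /h e scaler_eq0 (negPf c0).
have ih : incident M gamma h.
  move=> H dH x xH; have [u0 uH] := uP H dH; have [c c0 e] := normalizeE u0.
  by rewrite /h e pairingZ uH // mulr0.
have hpar H H' c : hyperplane H -> hyperplane H' -> h H' = c *: h H -> h H' = h H.
  move=> dH dH' e; have [u0 _] := uP H dH; have [u0' _] := uP H' dH'.
  have [a a0 ea] := normalizeE u0; have [b b0 eb] := normalizeE u0'.
  have c0 : c != 0 by apply: contraNneq (h0 H' dH') => c0; rewrite e c0 scale0r.
  rewrite /h; have -> : u H' = (b^-1 * c * a) *: u H.
    by rewrite -!scalerA -ea -/(h H) -e /h eb scalerK.
  by rewrite normalizeZ // !mulf_neq0 ?invr_eq0.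
have /choice [y yP] : forall v : 'rV[K]_n, exists y : {set E} -> 'rV[{poly K}]_n,
    v != 0 -> forall H H', hyperplane H -> hyperplane H' -> h H = v -> h H' = v -> H != H' ->
    separates gamma v H H' (y H) (y H').
  move=> v; have [->|v0] := eqVneq v 0; first by exists (fun=> 0).
  pose D := [set H : {set E} | hyperplane H & h H == v].
  have [||y yP] := @separating_motion gamma v D v0.
  - by move=> H x; rewrite inE => /andP [dH /eqP <-]; apply: ih.
  - move=> D' sD' gt1; apply: flex => // H /(fintype.subsetP sD');
    rewrite inE => /andP [dH /eqP <-].
    by split=> //; apply: ih.
  exists y => _ H H' dH dH' hH hH' HH'; apply: yP => //; rewrite inE ?dH ?dH' ?hH ?hH' eqxx //.
apply: (@separated_closure_point gamma h (fun H => map_mx polyC (h H) + 'X *: y (h H) H)) => //.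
  by move=> H; rewrite mx_at_lift.
move=> H H' dH dH' HH'; have [hE|hN] := eqVneq (h H') (h H).
  have [l [w [e wh wp]]] := yP (h H) (h0 H dH) H H' dH dH' erefl hE HH'.
  exists l.+1, w; split=> //.
  by rewrite hE opprD addrACA subrr add0r -scalerBr e scalerA exprS.
exists 0%N, (map_mx polyC (h H') + 'X *: y (h H') H' - (map_mx polyC (h H) + 'X *: y (h H) H)).
split; first by rewrite expr0 scale1r.
  move=> c; rewrite mx_atB !mx_at_lift; apply: contra hN => /eqP e; apply/eqP.
  by apply: (hpar _ _ (c + 1)) => //; rewrite scalerDl scale1r -e subrK.
by move=> x xH xH'; rewrite mx_atB !mx_at_lift pairingB !ih // subrr.
Qed.

End Degenerations.

(** * Rigid configurations *)

Section Rigidity.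
Variables (K : numFieldType) (n : nat) (E : finType).
Implicit Types (gamma : 'M[K]_(n, #|E|)) (h l : 'rV[K]_n).

(** The vectors of [H] span the kernel of [h], so a maximal free subfamily has n - 1 members and the
    same annihilator. *)
Lemma annihilator_basis gamma (H : {set E}) h : h != 0 ->
  (forall x, x \in H -> pairing gamma h x = 0) ->
  (forall l, (forall x, x \in H -> pairing gamma l x = 0) -> exists c, l = c *: h) ->
  exists B : {set E}, [/\ B \subset H, #|B| = n.-1 &
    forall l, (forall x, x \in B -> pairing gamma l x = 0) -> exists c, l = c *: h].
Proof.
move=> h0 hH ann; pose A : 'M[K]_(#|H|, n) := \matrix_(i, j) gamma j (enum_rank (enum_val i)).
have lA l i : (l *m A^T) 0 i = pairing gamma l (enum_val i).
  by rewrite mxE pairingE; apply: eq_bigr => j _; rewrite !mxE.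
have kerA l : l *m A^T = 0 <-> forall x, x \in H -> pairing gamma l x = 0.
  split=> [l0 x xH|lH]; last by apply/rowP=> i; rewrite lA mxE lH // enum_valP.
  by rewrite -(enum_rankK_in xH xH) -lA l0 mxE.
have kh : (kermx A^T == h)%MS.
  apply/andP; split; last by apply/sub_kermxP/kerA.
  apply/row_subP => i; have [|c ->] := ann (row i (kermx A^T)); last exact: scalemx_sub.
  by apply/kerA; rewrite -row_mul mulmx_ker row0.
have rA : \rank A = n.-1.
  have := mxrank_ker A^T; rewrite (eqmx_rank kh) rank_rV h0 mxrank_tr.
  by have := rank_leq_col A; lia.
exists [set enum_val (maxrankfun A i) | i in 'I_(\rank A)]; split.
- by apply/fintype.subsetP=> _ /imsetP [i _ ->]; apply: enum_valP.
- rewrite card_imset ?card_ord // => i j /enum_val_inj; exact: maxrankfun_inj.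
- move=> l lB; apply/ann/kerA.
  have /submxP [X AX] : (A <= rowsub (maxrankfun A) A)%MS by rewrite eq_maxrowsub.
  rewrite [X in X^T]AX trmx_mul mulmxA.
  suff -> : l *m (rowsub (maxrankfun A) A)^T = 0 by rewrite mul0mx.
  apply/rowP=> i; rewrite [RHS]mxE -[RHS](lB (enum_val (maxrankfun A i)));
    last by apply/imsetP; exists i.
  by rewrite -lA !mxE; apply: eq_bigr => j _; rewrite !mxE.
Qed.

(** For a basis [B] of the hyperplane, each n-set [y |: B] gives a linear form by
    [circuit_row_functional]. Two such forms agree on [B], so they differ by a multiple of [h],
    which vanishes on [H]. *)
Lemma circuit_rows_functional gamma (H : {set E}) q h (z : E -> K) :
  (0 < n)%N -> (n <= #|H|)%N -> h != 0 -> (h *m q) 0 0 != 0 ->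
  (forall x, x \in H -> pairing gamma h x = 0) ->
  (forall l, (forall x, x \in H -> pairing gamma l x = 0) -> exists c, l = c *: h) ->
  (forall C : {set E}, C \subset H -> #|C| = n ->
    \sum_x z x * mx_eval gamma (circuit_row (enum C) q x) = 0) ->
  exists l, forall x, x \in H -> z x = pairing gamma l x.
Proof.
move=> n0 leH h0 hq hH ann rows.
have [B [sB szB annB]] := annihilator_basis h0 hH ann.
have ext y : y \in H -> y \notin B -> exists l, forall x,
  x \in y |: B -> z x = pairing gamma l x.
  move=> yH yB; have sC : y |: B \subset H by apply/subUsetP; rewrite sub1set.
  have szC : #|y |: B| = n by rewrite cardsU1 yB szB add1n prednK.
  have [|||l lP] := circuit_row_functional n0 (enum_uniq (y |: B)) _ h0 hq _ _ (rows _ sC szC).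
  - by rewrite -cardE.
  - by move=> x; rewrite mem_enum => /(fintype.subsetP sC); apply: hH.
  - move=> l lC; apply: annB => x xB; apply: lC.
    by rewrite mem_enum in_setU1 xB orbT.
  by exists l => x xC; apply: lP; rewrite mem_enum.
have [y0 y0H y0B] : exists2 y0, y0 \in H & y0 \notin B.
  apply: contrapT => ny; have : H \subset B.
    by apply/fintype.subsetP=> y yH; apply: contraT => yB; case: ny; exists y.
  by move=> /subset_leq_card; rewrite szB; lia.
have [l lP] := ext y0 y0H y0B; exists l => y yH.
have [yB|yB] := boolP (y \in B); first by apply: lP; rewrite in_setU1 yB orbT.
have [l' l'P] := ext y yH yB; rewrite l'P ?setU11 //.
have [|c e] := annB (l' - l).
  by move=> x xB; rewrite pairingB -l'P -?lP ?subrr // in_setU1 xB orbT.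
by apply/eqP; rewrite -subr_eq0 -pairingB e pairingZ hH // mulr0.
Qed.

Variable M : matroid E.
Hypothesis Mpaving : paving M n.

(* Take for [J] one hyperplane of [D]: rigidity says that the matrix of circuit rows
   has independent columns outside [J], so some maximal minor is nonzero. *)
Lemma rigid_graph_poly gamma h (D : {set {set E}}) : h != 0 -> (1 < #|D|)%N ->
  (forall H, H \in D -> dep_hyperplane M n H /\ forall x, x \in H -> pairing gamma h x = 0) ->
  rigid gamma h D -> exists2 f, canonical_graph_poly K n M f & mx_eval gamma f != 0.
Proof.
move=> h0 gt1 hD rig; have [r hr] : exists r, h 0 r != 0 by have /rV0Pn := h0.
(* A canonical vector outside the kernel of [h], since [h 0 r] is nonzero. *)
pose q : 'cV[K]_n := delta_mx r 0.
have hq : (h *m q) 0 0 != 0 by rewrite -colE mxE.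
have [H0 [H1 [H0D H1D H01]]] : exists H0 H1, [/\ H0 \in D, H1 \in D & H0 != H1].
  by have /card_gt1P [H0 [H1 []]] := gt1; exists H0, H1.
have [dH0 _] := hD H0 H0D; have n0 := dep_hyperplane_gt0 dH0.
(* Moving [H] alone by a form that kills it is compatible. Comparison with a second hyperplane of
   [D] then makes this form a multiple of [h], by rigidity. *)
have ann H l : H \in D -> (forall x, x \in H -> pairing gamma l x = 0) -> exists c, l = c *: h.
  move=> HD lH; have [H' H'D HH'] : exists2 H', H' \in D & H' != H.
    by have [e|ne] := eqVneq H0 H; [exists H1; rewrite // -e eq_sym | exists H0].
  have p0 y : pairing gamma 0 y = 0 by rewrite pairingE big1 // => i _; rewrite mxE mul0r.
  have [|c] := rig (fun Z => if Z == H then l else 0) _ H' H H'D HD.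
    move=> Z Z' y _ _ yZ yZ'.
    have lZ (Y : {set E}) : y \in Y -> pairing gamma (if Y == H then l else 0) y = 0.
      by move=> yY; case: eqP => [YH|_]; rewrite ?p0 // lH // -YH.
    by rewrite !lZ.
  by rewrite eqxx (negPf HH') subr0; exists c.
pose P := cover D :\: H0.
pose R := [set C : {set E} | [exists H in D, C \subset H] & #|C| == n].
pose A : 'M[K]_(#|R|, #|P|) := \matrix_(i, j)
  mx_eval gamma (circuit_row (enum (enum_val i : {set E})) q (enum_val j)).
have fullA : row_full A.
  rewrite /row_full -mxrank_tr -/(row_free A^T); apply/inj_row_free => v vA.
  (* A kernel vector extended by zero outside [P]. On each hyperplane of [D] it is a linear form,
     and these forms are a compatible motion. By rigidity they agree modulo [h] with the form of
     [H0], which kills [H0] and so is itself a multiple of [h]. *)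
  pose z x := \sum_(j | enum_val j == x) v 0 j.
  have zP j : z (enum_val j) = v 0 j.
    by rewrite /z (big_pred1 j) // => i; rewrite (inj_eq enum_val_inj).
  have zN x : x \notin P -> z x = 0.
    move=> xP; rewrite /z big_pred0 // => j; apply: contraNF xP => /eqP <-; exact: enum_valP.
  have rows C : C \in R -> \sum_x z x * mx_eval gamma (circuit_row (enum C) q x) = 0.
    move=> CR; have := congr1 (fun w : 'rV_ _ => w 0 (enum_rank_in CR C)) vA.
    rewrite [RHS]mxE => e; rewrite -[RHS]e mxE.
    rewrite (bigID (fun x => x \in P)) /= [X in _ + X]big1 ?addr0 => [|x xP];
      last by rewrite zN ?mul0r.
    rewrite big_enum_val /=; apply: eq_bigr => j _.
    by rewrite zP !mxE enum_rankK_in.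
  have /fin_all_exists [l lP] : forall H : {set E}, exists l, H \in D ->
      forall x, x \in H -> z x = pairing gamma l x.
    move=> H; have [HD|] := boolP (H \in D); last by exists 0.
    have [dH hH] := hD H HD; have [leH _ _] := dep_hyperplaneP dH.
    have [|l lP] := @circuit_rows_functional gamma H q h z n0 leH h0 hq hH (fun l =>
      ann H l HD); last by exists l.
    move=> C sC szC; apply: rows; rewrite inE szC eqxx andbT.
    by apply/existsP; exists H; rewrite HD.
  have lH0 : exists c, l H0 = c *: h.
    by apply: (ann H0) => // x xH0; rewrite -lP // zN // inE xH0.
  have [c0 l0E] := lH0.
  have z0 x : z x = 0.
    have [|xP] := boolP (x \in P); last exact: zN.
    rewrite inE => /andP [_ /bigcupP [H HD xH]].
    have [|c e] := rig l _ H0 H H0D HD.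
      by move=> Z Z' y ZD Z'D yZ yZ'; rewrite -!lP.
    have [_ hH] := hD H HD.
    by rewrite (lP H) // -[l H](subrK (l H0)) e l0E -scalerDl pairingZ hH // mulr0.
  by apply/rowP=> j; rewrite -zP z0 mxE.
have detA : \det (rowsub (fullrankfun fullA) A) != 0.
  by rewrite -unitfE -unitmxE fullrowsub_unit.
pose s i := enum (enum_val (fullrankfun fullA i) : {set E}).
have pE : [set (enum_val j : E) | j in 'I_#|P|] = P.
  apply/setP=> x; apply/imsetP/idP => [[j _ ->]|xP]; first exact: enum_valP.
  by exists (enum_rank_in xP x); rewrite ?enum_rankK_in.
have P0 : (0 < #|P|)%N.
  rewrite card_gt0; apply: contraNneq H01 => P0.
  have sH : H1 \subset H0.
    apply: subset_trans (bigcup_sup H1 H1D) _.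
    by rewrite -setD_eq0 -/P P0.
  have [_ cH0 _] := dep_hyperplaneP dH0; have [_ _ m1] := dep_hyperplaneP (hD H1 H1D).1.
  by apply/eqP/m1.
have := @det_circuit_rows K n E M H0 #|P| (fun j => enum_val j) s q P0 (@enum_val_inj _ _).
have detE : mx_eval gamma (\det (\matrix_(i, j) circuit_row (s i) q (enum_val j))) != 0.
  rewrite mx_eval_det; move: detA; congr (_ != 0); congr (\det _).
  by apply/matrixP=> i j; rewrite !mxE.
case.
- rewrite pE; apply/pred0P => x /=; apply/negP => /andP [+ xH0].
  by rewrite inE (fintype.subsetP (dep_hyperplane_closure Mpaving dH0) x xH0).
- move=> i; have := enum_valP (fullrankfun fullA i); rewrite inE.
  move=> /andP [/existsP [H /andP [HD sC]] /eqP szC].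
  have [dH _] := hD H HD; have [_ cH _] := dep_hyperplaneP dH.
  have sE : [set x in s i] = enum_val (fullrankfun fullA i).
    by apply/setP=> x; rewrite inE mem_enum.
  split; rewrite ?sE.
  + exact: cH.
  + exact: enum_uniq.
  + by rewrite -cardE.
  + rewrite pE; apply/fintype.subsetP=> x xC; rewrite !inE.
    case: (x \in H0); rewrite //= orbF.
    by apply/bigcupP; exists H => //; apply: fintype.subsetP sC x xC.
- by move=> d0; rewrite d0 mx_evalE meval0 eqxx in detE.
move=> [c [b [gc dE]]]; exists (graph_polynomial (fun j => enum_val j) c (fun=> q)).
  by exists H0, #|P|, (fun j => enum_val j), c, (fun=> q); split=> // _; exists r.
move: detE; rewrite dE mx_evalE rmorphM rmorphXn rmorphN1.
by rewrite mulf_eq0 signr_eq0.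
Qed.

End Rigidity.

(** * The matroid ideal *)

Section Finiteness.
Variables (K : fieldType) (n : nat) (E : finType) (M : matroid E).
Local Open Scope classical_set_scope.

(** The size of a minor is at most n because its rows are increasing, and each size leaves finitely
    many choices of rows and columns. *)
Lemma finite_circuit_minor : finite_set (circuit_minor K n M).
Proof.
pose F r (x : {ffun 'I_r -> 'I_n} * {ffun 'I_r -> 'I_#|E|}) : {mxpoly K[n, E]} :=
  \det (mxsub x.1 x.2 (generic_mx K n E)).
apply: (@sub_finite_set _ _ (\bigcup_(r in `I_n.+1) range (F r))); last first.
  apply: bigcup_finite; first exact: finite_II.
  by move=> r _; apply/finite_image/finite_finset.
move=> f [r [a [b [inc_a _ _ ->]]]].
have ltr : (r < n.+1)%N.
  by rewrite ltnS -[r]card_ord -[X in (_ <= X)%N]card_ord (leq_card _ (increasing_inj inc_a)).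
exists r; first exact: ltr.
exists ([ffun i => a i], [ffun i => b i]); first by [].
by rewrite /F; congr (\det _); apply/matrixP=> i j; rewrite !mxE !ffunE.
Qed.

(** The polynomial is determined by [p], the n-tuples [c i] and the indices of the canonical
    vectors, and [k] is at most |E| since [p] is injective. *)
Lemma finite_canonical_graph_poly : finite_set (canonical_graph_poly K n M).
Proof.
pose F k (x : {ffun 'I_k -> E} * {ffun 'I_k -> n.-tuple E} * {ffun 'I_k -> 'I_n}) :
    {mxpoly K[n, E]} :=
  graph_polynomial x.1.1 (fun i => tval (x.1.2 i)) (fun i => delta_mx (x.2 i) 0).
apply: (@sub_finite_set _ _ (\bigcup_(k in `I_#|E|.+1) range (F k))); last first.
  apply: bigcup_finite; first exact: finite_II.
  by move=> k _; apply/finite_image/finite_finset.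
move=> f [J [k [p [c [q [[_ inj_p _ cP] /fin_all_exists [r qE] ->]]]]]].
have ltk : (k < #|E|.+1)%N by rewrite ltnS -[k]card_ord (leq_card _ inj_p).
have szc i : size (c i) == n.
  by have [[_ _ sz] _] := cP i; apply/eqP.
exists k; first exact: ltk.
exists ([ffun i => p i], [ffun i => Tuple (szc i)], [ffun i => r i]); first by [].
have pE : ([ffun i => p i] : 'I_k -> E) = p by apply/funext => i; rewrite ffunE.
have cE : (fun i => tval ([ffun i => Tuple (szc i)] i)) = c by apply/funext => i; rewrite ffunE.
have rE : (fun i => delta_mx ([ffun i => r i] i) 0) = q by apply/funext => i; rewrite ffunE qE.
by rewrite /F /fst /snd pE cE rE.
Qed.

End Finiteness.

Section IdealOperations.
Variable A : comNzRingType.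
Implicit Types I J : set A.

Lemma ideal_addP I J : is_ideal I -> is_ideal J -> is_ideal (ideal_add I J).
Proof.
move=> [I0 ID IM] [J0 JD JM]; split.
- by exists 0 => //; exists 0 => //; rewrite addr0.
- move=> _ _ [a Ia [b Jb <-]] [a' Ia' [b' Jb' <-]].
  exists (a + a'); first exact: ID; exists (b + b'); first exact: JD.
  by rewrite addrACA.
- move=> x _ [a Ia [b Jb <-]]; exists (x * a); first exact: IM.
  by exists (x * b); [apply: JM | rewrite mulrDr].
Qed.

Lemma ideal_addl I J a : is_ideal J -> I a -> ideal_add I J a.
Proof. by move=> [J0 _ _] Ia; exists a => //; exists 0 => //; rewrite addr0. Qed.

Lemma ideal_addr I J a : is_ideal I -> J a -> ideal_add I J a.
Proof. by move=> [I0 _ _] Ja; exists 0 => //; exists a => //; rewrite add0r. Qed.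

End IdealOperations.

Section MatroidIdeal.
Variables (K : numClosedFieldType) (n : nat) (E : finType) (M : matroid E).
Hypothesis K_large : large_fibre K.
Hypothesis Mpaving : paving M n.
Hypothesis Mdegree : forall p : E, (degree M n p <= 2)%N.
Local Open Scope classical_set_scope.
Local Notation ring := {mxpoly K[n, E]}.

Lemma is_ideal_zero_at (gamma : 'M[K]_(n,
  #|E|)) : is_ideal (fun g : ring => mx_eval gamma g = 0).
Proof.
split=> [|a b|a b]; rewrite !mx_evalE.
- exact: meval0.
- by move=> a0 b0; rewrite mevalD a0 b0 addr0.
- by move=> b0; rewrite mevalM b0 mulr0.
Qed.

Lemma canonical_graph_poly_graph f : canonical_graph_poly K n M f -> graph_poly K n M f.
Proof. by move=> [J [k [p [c [q [gc _ ->]]]]]]; exists J, k, p, c, q. Qed.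

(** By [rigid_graph_poly], no family of hyperplanes with a common normal is rigid at [gamma]. *)
Lemma zero_set_closure_point (gamma : 'M[K]_(n, #|E|)) :
  (forall f, circuit_minor K n M f -> mx_eval gamma f = 0) ->
  (forall f, canonical_graph_poly K n M f -> mx_eval gamma f = 0) ->
  closure_point M gamma.
Proof.
move=> zc zg; apply: flexible_closure_point => //.
  by move=> C; apply: circuit_minors_dependent.
move=> h D h0 gt1 hD rig; have [f /zg f0] := rigid_graph_poly Mpaving h0 gt1 hD rig.
by rewrite f0 eqxx.
Qed.

Lemma matroid_ideal_canonical : matroid_ideal K n M `<=`
  radical (ideal_gen (circuit_minor K n M `|` canonical_graph_poly K n M)).
Proof.
move=> f /matroid_idealP If; apply: (strong_nullstellensatz K_large); first exact: ideal_genP.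
move=> v zv; pose gamma : 'M[K]_(n, #|E|) := vec_mx (\row_i v i).
have evE g : mx_eval gamma g = g.@[v].
  by rewrite mx_evalE vec_mxK; apply: meval_eq => i; rewrite mxE.
rewrite -evE; suff cl : closure_point M gamma by apply: cl.
apply: zero_set_closure_point => g Gg; rewrite evE; apply: (zv); apply: mem_ideal_gen.
  by left.
by right.
Qed.

Lemma canonical_radical_sub :
  radical (ideal_gen (circuit_minor K n M `|` canonical_graph_poly K n M)) `<=`
  radical (ideal_add (circuit_ideal K n M) (graph_ideal K n M)).
Proof.
have idC := ideal_genP (circuit_minor K n M); have idG := ideal_genP (graph_poly K n M).
move=> f [k Ifk]; exists k; apply: ideal_gen_sub Ifk; first exact: ideal_addP.
move=> g [Cg|/canonical_graph_poly_graph Gg].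
  by apply: ideal_addl => //; apply: mem_ideal_gen.
by apply: ideal_addr => //; apply: mem_ideal_gen.
Qed.

Lemma radical_sub_matroid_ideal :
  radical (ideal_add (circuit_ideal K n M) (graph_ideal K n M)) `<=` matroid_ideal K n M.
Proof.
move=> f [k [a Ia [b Jb abE]]]; apply/matroid_idealP => gamma rg.
have idZ := is_ideal_zero_at gamma.
have a0 : mx_eval gamma a = 0.
  by apply: (ideal_gen_sub idZ _ Ia) => g; apply: circuit_minor_vanish.
have b0 : mx_eval gamma b = 0.
  by apply: (ideal_gen_sub idZ _ Jb) => g; apply: graph_poly_vanish.
have : mx_eval gamma (f ^+ k) == 0 by rewrite -abE mx_evalE mevalD -!mx_evalE a0 b0 addr0.
by rewrite mx_evalE rmorphXn expf_eq0 => /andP [_ /eqP].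
Qed.

End MatroidIdeal.

Local Open Scope classical_set_scope.
Local Open Scope ring_scope.

Theorem theorem1p5 (R : realType) (n : nat) (E : finType) (M : matroid E)
    (Mpaving : paving M n) :
  (lift_ideal R[i] n M `<=` graph_ideal R[i] n M) /\
  ((forall p : E, (degree M n p <= 2)%N) ->
    [/\ matroid_ideal R[i] n M =
          radical (ideal_add (circuit_ideal R[i] n M) (graph_ideal R[i] n M)),
        finite_set (circuit_minor R[i] n M),
        finite_set (canonical_graph_poly R[i] n M)
      & matroid_ideal R[i] n M =
          radical (ideal_gen
            (circuit_minor R[i] n M `|` canonical_graph_poly R[i] n M))]).
Proof.
split; first by apply: ideal_gen_sub; [apply: ideal_genP | apply: lift_poly_graph_ideal].
move=> Mdegree.
(* Three inclusions in a circle, which give both equalities. *)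
have sub1 := matroid_ideal_canonical (@complex_large_fibre R) Mpaving Mdegree.
have sub2 := @canonical_radical_sub R[i] n E M.
have sub3 := @radical_sub_matroid_ideal R[i] n E M.
split.
- by apply/seteqP; split=> // f /sub1 /sub2.
- exact: finite_circuit_minor.
- exact: finite_canonical_graph_poly.
- by apply/seteqP; split=> // f /sub2 /sub3.
Qed.
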